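(* Let $\Omega\subseteq\mathbb R^n$, $n\ge2$, be a connected open set, and let $V\in L^2_{loc}(\Omega)$. Let $u=(u_1,\ldots,u_M):\Omega\to\mathbb R^M$ satisfy $u\in H^1_{loc}(\Omega)$ and $|\nabla u|\le V|u|$ a.e. on $\Omega$. If $u$ vanishes (a.e.) in a nonempty open subset of $\Omega$, then $u$ vanishes identically on $\Omega$ (i.e. $u=0$ a.e.).
   Context: $H^1_{loc}(\Omega)=W^{1,2}_{loc}(\Omega)$ (componentwise), with $\nabla u$ the weak gradient; for $u:\Omega\to\mathbb R^M$, $|u|=\left(\sum_{k=1}^M|u_k|^2\right)^{1/2}$ and $|\nabla u|=\left(\sum_{j=1}^n\sum_{k=1}^M|\partial_{x_j}u_k|^2\right)^{1/2}$. *)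

(* Defs.v *)
From HB Require Import structures.
From mathcomp Require Import all_boot all_order all_algebra.
From mathcomp Require Import all_classical all_reals all_analysis.
From mathcomp Require Import measurable_realfun.

Set Implicit Arguments.
Unset Strict Implicit.
Unset Printing Implicit Defensive.

Import Order.TTheory GRing.Theory Num.Theory.
Import numFieldNormedType.Exports.

Local Open Scope classical_set_scope.
Local Open Scope ring_scope.

Definition measure_rV_display : measure_display -> measure_display.
Proof. exact. Qed.

(* 'rV[R]_n carries the topology of R^n (sup norm) but no sigma-algebra in the
   library.  The product sigma-algebra is the Borel one, see
   open_measurable_rV. *)
Section measurable_rV.
Context {d} {T : measurableType d}.
Variable n : nat.

Let coor : 'I_n -> 'rV[T]_n -> T := fun i x => x ord0 i.

Let rV_set0 : g_sigma_preimage coor set0.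
Proof. exact: sigma_algebra0. Qed.

Let rV_setC A : g_sigma_preimage coor A -> g_sigma_preimage coor (~` A).
Proof. exact: sigma_algebraC. Qed.

Let rV_bigcup (F : _^nat) : (forall i, g_sigma_preimage coor (F i)) ->
  g_sigma_preimage coor (\bigcup_i (F i)).
Proof. exact: sigma_algebra_bigcup. Qed.

HB.instance Definition _ := @isMeasurable.Build (measure_rV_display d)
  'rV[T]_n (g_sigma_preimage coor) rV_set0 rV_setC rV_bigcup.

End measurable_rV.

Lemma measurable_coord_rV d (T : measurableType d) n (i : 'I_n) :
  measurable_fun [set: 'rV[T]_n] (fun x => x ord0 i).
Proof.
move=> _ Y mY; rewrite setTI; apply: sub_sigma_algebra => /=.
rewrite -bigcup_seq/=; exists i => /=; first by rewrite mem_index_enum.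
by exists Y => //; rewrite setTI.
Qed.

Lemma measurable_fun_rV d1 d2 (T1 : measurableType d1) (T2 : measurableType d2)
    n (f : T1 -> 'rV[T2]_n) :
  (forall i, measurable_fun [set: T1] (fun x => f x ord0 i)) ->
  measurable_fun [set: T1] f.
Proof.
move=> mf _ A mA; pose coor i (x : 'rV[T2]_n) := x ord0 i.
suff : g_sigma_preimage (fun i => coor i \o f) `<=` measurable.
  by rewrite g_sigma_preimage_comp; apply; exists A.
apply: smallest_sub; first exact: sigma_algebra_measurable.
case: n => [|n] in f mf A mA coor *; first by rewrite big_ord0.
rewrite -bigcup_mkord_ord; apply: bigcup_sub => i Ii.
by move=> B [C mC <-]; exact: mf.
Qed.

Lemma open_measurable_rV (R : realType) n (A : set 'rV[R]_n) :
  open A -> measurable A.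
Proof.
move=> oA.
pose B (c : 'rV[rat]_n * nat) : set 'rV[R]_n :=
  [set x | forall i, `|ratr (c.1 ord0 i) - x ord0 i| < c.2.+1%:R^-1].
have mB c : measurable (B c).
  rewrite (_ : B c = \bigcap_(i in [set: 'I_n])
    ((fun x : 'rV[R]_n => x ord0 i) @^-1`
       [set y | `|ratr (c.1 ord0 i) - y| < c.2.+1%:R^-1])); last first.
    by apply/seteqP; split=> x /= Bx i *; exact: Bx.
  apply: fin_bigcap_measurable => // i _.
  rewrite -[X in measurable X]setTI; apply: measurable_coord_rV => //.
  exact: (measurable_ball (ratr (c.1 ord0 i)) c.2.+1%:R^-1).
rewrite (_ : A = \bigcup_(k : nat) if unpickle k is Some c then
    [set x | B c `<=` A /\ B c x] else set0).
  apply: bigcupT_measurable => k; case: unpickle => // c.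
  have [BA|BA] := pselect (B c `<=` A).
    by rewrite (_ : mkset _ = B c)//; apply/seteqP; split=> x //= -[].
  by rewrite (_ : mkset _ = set0)//; apply/seteqP; split=> x //= -[].
apply/seteqP; split=> [x Ax|x [k _]]; last first.
  by case: unpickle => //= c [+ Bx]; exact.
have /nbhs_ballP[e e0 eA] : nbhs x A by exact: open_nbhs_nbhs.
have [k ke] : exists k : nat, k.+1%:R^-1 < e / 2.
  have := near_infty_natSinv_lt (PosNum (divr_gt0 e0 (ltr0n R 2))).
  by case=> k _ /(_ k (leqnn _)) ke; exists k.
have q i : {q : rat | `|ratr q - x ord0 i| < k.+1%:R^-1}.
  apply: cid.
  have /rat_in_itvoo[q] : x ord0 i - k.+1%:R^-1 < x ord0 i + k.+1%:R^-1.
    by rewrite ltrBlDr -addrA ltrDl addr_gt0.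
  rewrite in_itv/= => qx; exists q.
  by rewrite distrC ltr_distlC.
pose c := (\row_i sval (q i), k).
exists (pickle c) => //; rewrite pickleK; split => /= [y By|i]; last first.
  by rewrite mxE; case: (q i).
apply: eA; split => // i j; rewrite ord1 /ball/=.
have := By j; have := svalP (q j); rewrite /= mxE => qx qy.
rewrite -(subrKA (ratr (sval (q j)))) (le_lt_trans (ler_normD _ _))//.
rewrite (splitr e) ltrD//; last exact: lt_trans ke.
by rewrite distrC; exact: lt_trans ke.
Qed.

Definition rV_cons (T : Type) n (p : T * 'rV[T]_n) : 'rV[T]_n.+1 :=
  \row_i if unlift ord0 i is Some j then p.2 ord0 j else p.1.

(* Lebesgue measure on R^n, as the n-fold product of lebesgue_measure on R *)
Fixpoint lebesgue_rV (R : realType) n : set 'rV[R]_n -> \bar R :=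
  match n with
  | 0 => \d_(0 : 'rV[R]_0)
  | n'.+1 =>
    pushforward (@lebesgue_measure R \x @lebesgue_rV R n')%E (@rV_cons R n')
  end.
Arguments lebesgue_rV {R n}.

Lemma rV_cons0 (T : Type) n (p : T * 'rV[T]_n) : rV_cons p ord0 ord0 = p.1.
Proof. by rewrite mxE unlift_none. Qed.

Lemma rV_consS (T : Type) n (p : T * 'rV[T]_n) i :
  rV_cons p ord0 (lift ord0 i) = p.2 ord0 i.
Proof. by rewrite mxE liftK. Qed.

Lemma measurable_rV_cons (R : realType) n :
  measurable_fun [set: measurableTypeR R * 'rV[R]_n] (@rV_cons R n).
Proof.
apply: measurable_fun_rV => i; case: (unliftP ord0 i) => [j|] ->.
  under eq_fun do rewrite rV_consS.
  apply: (measurableT_comp (measurable_coord_rV j)); exact: measurable_snd.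
by under eq_fun do rewrite rV_cons0; exact: measurable_fst.
Qed.

Section sigma_finite_measure_ex.
Context d (T : measurableType d) (R : realType) (mu : set T -> \bar R).
Hypotheses (mu0 : mu set0 = 0%E) (mu_ge0 : forall A, (0 <= mu A)%E).
Hypotheses (mu_sa : semi_sigma_additive mu) (mu_sf : sigma_finite setT mu).

Let m := mu.

HB.instance Definition _ := isMeasure.Build _ _ _ m mu0 mu_ge0 mu_sa.
HB.instance Definition _ := Measure_isSigmaFinite.Build _ _ _ m mu_sf.

Lemma sigma_finite_measure_ex :
  {m : {sigma_finite_measure set T -> \bar R} | mu = m :> (_ -> _)}.
Proof. by exists m. Qed.

End sigma_finite_measure_ex.

Section lebesgue_rV_measure.
Context {R : realType}.

Let sigma_finite_lebesgue_rV_ex n :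
  {m : {sigma_finite_measure set 'rV[R]_n -> \bar R} | lebesgue_rV = m :> (_ -> _)}.
Proof.
elim: n => [|n [m mE]].
  by exists (\d_(0 : 'rV[R]_0) : {sigma_finite_measure set _ -> \bar R}).
pose mx : {measure set (measurableTypeR R * 'rV[R]_n)%type -> \bar R} :=
  (@lebesgue_measure R \x m)%E.
have mC : measurable_fun setT (@rV_cons R n) by exact: measurable_rV_cons.
pose P := pushforward mx (@rV_cons R n).
have P0 : P set0 = 0%E by rewrite /P /pushforward preimage_set0 measure0.
have Pge0 A : (0 <= P A)%E by exact: (measure_ge0 mx).
have Psa : semi_sigma_additive P.
  rewrite /P; apply: measure_semi_sigma_additive => *; exact: mC.
have Psf : sigma_finite setT P.
  have [F FT Foo] : sigma_finite setT mx.
    have /sigma_finiteP[F [TF ndF Foo]] := sigma_finiteT (@lebesgue_measure R).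
    have /sigma_finiteP[G [TG ndG Goo]] := sigma_finiteT m.
    exists (fun k => F k `*` G k).
      rewrite -setXTT TF TG predeqE => -[x y]; split.
        move=> [/= [i _ Fx] [k _ Gy]]; exists (maxn i k) => //; split.
        - by move: x Fx; exact/subsetPset/ndF/leq_maxl.
        - by move: y Gy; exact/subsetPset/ndG/leq_maxr.
      by move=> [i _ []/= ? ?]; split; exists i.
    move=> k; have [? ?] := Foo k; have [? ?] := Goo k.
    split; first exact: measurableX.
    by rewrite /mx/= product_measure1E// lte_mul_pinfty// ge0_fin_numE.
  pose g (x : 'rV[R]_n.+1) : measurableTypeR R * 'rV[R]_n :=
    (x ord0 ord0, \row_i x ord0 (lift ord0 i)).
  have gK p : g (rV_cons p) = p.
    case: p => a b; rewrite /g rV_cons0; congr pair.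
    by apply/rowP => i; rewrite mxE rV_consS.
  have mg : measurable_fun setT g.
    apply: measurable_fun_pair; first exact: measurable_coord_rV.
    apply: measurable_fun_rV => i; under eq_fun do rewrite mxE.
    exact: measurable_coord_rV.
  exists (fun i => g @^-1` F i).
    by rewrite -preimage_bigcup -FT preimage_setT.
  move=> i; have [mF Fi] := Foo i; split.
    by rewrite -[X in measurable X]setTI; exact: mg.
  by rewrite /P /pushforward -comp_preimage (_ : g \o _ = id)//; exact/funext.
have [m' m'E] := sigma_finite_measure_ex P0 Pge0 Psa Psf.
by exists m'; rewrite -m'E /= mE.
Qed.

Variable n : nat.
Local Notation mu := (@lebesgue_rV R n).

Let lebesgue_rV0 : mu set0 = 0%E.
Proof. by have [m ->] := sigma_finite_lebesgue_rV_ex n. Qed.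

Let lebesgue_rV_ge0 A : (0 <= mu A)%E.
Proof. by have [m ->] := sigma_finite_lebesgue_rV_ex n. Qed.

Let lebesgue_rV_semi_sigma_additive : semi_sigma_additive mu.
Proof.
have [m ->] := sigma_finite_lebesgue_rV_ex n.
exact: measure_semi_sigma_additive.
Qed.

HB.instance Definition _ := isMeasure.Build _ _ _ mu
  lebesgue_rV0 lebesgue_rV_ge0 lebesgue_rV_semi_sigma_additive.

Let lebesgue_rV_sigma_finite : sigma_finite setT mu.
Proof.
have [m ->] := sigma_finite_lebesgue_rV_ex n; exact: sigma_finiteT.
Qed.

HB.instance Definition _ := Measure_isSigmaFinite.Build _ _ _ mu
  lebesgue_rV_sigma_finite.

End lebesgue_rV_measure.

Lemma lebesgue_rV_box (R : realType) n (A : 'I_n -> set R) :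
  (forall i, measurable (A i)) ->
  lebesgue_rV [set x : 'rV[R]_n | forall i, A i (x ord0 i)] =
  (\prod_(i < n) lebesgue_measure (A i))%E.
Proof.
elim: n => [|n IHn] in A * => mA.
  rewrite big_ord0 /= diracE mem_set//; first by case.
rewrite big_ord_recl -IHn; last by move=> i; exact: mA.
rewrite -product_measure1E//=; last 2 first.
- exact: mA.
- rewrite (_ : mkset _ = \bigcap_(i in [set: 'I_n])
    ((fun x : 'rV[R]_n => x ord0 i) @^-1` A (lift ord0 i))); last first.
    by apply/seteqP; split=> x /= Bx i *; exact: Bx.
  apply: fin_bigcap_measurable => // i _.
  by rewrite -[X in measurable X]setTI; exact: measurable_coord_rV.
rewrite /pushforward; congr (product_measure1 _ _ _).
apply/seteqP; split=> -[a b] /= H.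
  split; first by have := H ord0; rewrite rV_cons0.
  by move=> i; have := H (lift ord0 i); rewrite rV_consS.
move=> i; case: (unliftP ord0 i) => [j|] ->.
  by rewrite rV_consS; exact: H.2.
by rewrite rV_cons0; exact: H.1.
Qed.

Section sobolev.
Context {R : realType} {n : nat}.
Implicit Types (Omega K : set 'rV[R]_n) (f g phi : 'rV[R]_n -> R) (j : 'I_n).

Definition pderiv j f : 'rV[R]_n -> R := 'D_(delta_mx ord0 j) f.

Definition smooth f := forall s : seq 'I_n,
  continuous (foldr pderiv f s) /\
  forall j x, derivable (foldr pderiv f s) x (delta_mx ord0 j).

(* C_c^oo(Omega), its elements being extended by 0 to R^n *)
Definition test_function Omega phi :=
  [/\ smooth phi,
      compact (closure [set x | phi x != 0]) &
      closure [set x | phi x != 0] `<=` Omega].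

(* L^p_loc(Omega).  A locally p-integrable class is represented by a Borel
   function; values outside Omega are irrelevant. *)
Definition Lploc (p : nat) Omega f :=
  measurable_fun Omega f /\
  forall K, compact K -> K `<=` Omega ->
    (\int[lebesgue_rV]_(x in K) (`|f x| ^+ p)%:E < +oo)%E.

(* g is the weak partial derivative of f along the j-th coordinate *)
Definition weak_pderiv Omega j f g :=
  [/\ Lploc 1 Omega f, Lploc 1 Omega g &
      forall phi, test_function Omega phi ->
        \int[lebesgue_rV]_(x in Omega) (f x * pderiv j phi x) =
        - \int[lebesgue_rV]_(x in Omega) (g x * phi x)].

Definition H1loc Omega f := Lploc 2 Omega f /\
  forall j, exists2 g, Lploc 2 Omega g & weak_pderiv Omega j f g.

(* the weak gradient of u : Omega -> R^M, as the matrix (d u_k / d x_j)_(j,k) *)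
Definition weak_gradient Omega M (u : 'rV[R]_n -> 'rV[R]_M)
    (Du : 'rV[R]_n -> 'M[R]_(n, M)) :=
  forall j k, weak_pderiv Omega j (fun x => u x ord0 k) (fun x => Du x j k).

End sobolev.

(* the library norm `|A| on matrices is the sup norm *)
Definition enorm (R : realType) m n (A : 'M[R]_(m, n)) : R :=
  Num.sqrt (\sum_(i < m) \sum_(j < n) `|A i j| ^+ 2).

(* Main.v *)
Require Import Defs.
From HB Require Import structures.
From mathcomp Require Import all_boot all_order all_algebra.
From mathcomp Require Import all_classical all_reals all_analysis.
From mathcomp Require Import measurable_realfun ring lra.

Set Implicit Arguments.
Unset Strict Implicit.
Unset Printing Implicit Defensive.

Import Order.TTheory GRing.Theory Num.Theory.
Import numFieldNormedType.Exports.

Local Open Scope classical_set_scope.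
Local Open Scope ring_scope.

(** Unique continuation on lines.  Testing the weak derivative in direction [j]
    against smooth approximations of [(d - x_j) 1_box(x)] and applying Fubini
    gives, for almost every line parallel to the [j]-axis,
    [int_a^d u = int_a^d (d - t) (d_j u) dt] for all [d], as soon as [u] vanishes
    on a slab [a < x_j < a1] of the box; differentiating in [d],
    [u(t) = int_a^t d_j u].  On almost every such line [V] is integrable, so
    [|d_j u| <= V |u|] and Gronwall force [u = 0] there.  Hence the zero set
    spreads from a small box to any larger box inside [Omega], one coordinate at
    a time and in both senses, and connectedness concludes. *)

(** The weight [d - t] vanishes at the upper face, so integrating by parts leaves no boundary value
    of [u] there, which an integrable class does not have; near the lower face [u] itself vanishes
    and absorbs the blow-up of the cutoff's derivative. The side cutoffs are not differentiated, so
    their steepness is harmless. What remains is an identity between integrals that depend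
    continuously on [d]. This makes the passage to lines possible: for each [d] the exceptional null
    set of lines depends on [d], so only rational [d] are used at first, and continuity along the
    line gives the others. On a line [V] is merely integrable, not bounded, and Gronwall's lemma has
    to be proved for such coefficients. Both senses of a sweep are one statement, for a coordinate
    carrying a sign. Finally, the boxes on which [u] vanishes form an uncountable family, so boxes
    with rational corners collect the null sets. *)

Section flat_bump.
Context {R : realType}.
Implicit Types (p : {poly R}) (f h : R -> R) (x y z : R).

(* [flat 1 y = exp(-1/y)] for [y > 0]; the polynomial factors are those of its
   iterated derivatives. *)
Definition flat p y : R := if 0 < y then p.[y^-1] * expR (- y^-1) else 0.

Lemma horner_le_expr p : exists2 C, 0 <= C &
  forall z, 1 <= z -> `|p.[z]| <= C * z ^+ size p.
Proof.
exists (\sum_(i < size p) `|p`_i|); first by apply: sumr_ge0.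
move=> z z1; rewrite horner_coef (le_trans (ler_norm_sum _ _ _))//.
rewrite mulr_suml ler_sum// => i _.
rewrite normrM ler_wpM2l// normrX ger0_norm ?(le_trans ler01)//.
by rewrite ler_weXn2l// ltnW.
Qed.

(** With [z = 1/y >= 1], the exponential dominates [z^(s+2) / (s+2)!] for [s = size p], two degrees
    above the growth of [p]. The surplus is the factor [y ^+ 2], enough for differentiability at
    0. *)
Lemma flat_le_sqr p : exists2 C, 0 <= C &
  forall y, y <= 1 -> `|flat p y| <= C * y ^+ 2.
Proof.
have [C C0 HC] := horner_le_expr p.
exists (C * ((size p).+2)`!%:R); first by rewrite mulr_ge0.
move=> y y1; rewrite /flat; case: ifPn => [y0|_]; last first.
  by rewrite normr0 mulr_ge0 ?sqr_ge0 ?mulr_ge0.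
have [z zE] : {z | z = y^-1} by exists y^-1.
rewrite -zE; have z1 : 1 <= z by rewrite zE invf_ge1.
have z0 : 0 < z by rewrite (lt_le_trans ltr01).
rewrite normrM (ger0_norm (expR_ge0 _)) expRN.
rewrite ler_pdivrMr ?expR_gt0//.
apply: (le_trans (HC _ z1)).
have := expR_ge1Dxn (size p).+1 (ltW z0).
set e := expR z; set F := _%:R => H.
have F0 : 0 < F by rewrite ltr0n fact_gt0.
have {}H : z ^+ (size p).+2 <= F * e.
  by rewrite mulrC -ler_pdivrMr//; apply: le_trans H; rewrite lerDr.
have -> : y = z^-1 by rewrite zE invrK.
rewrite -(mulrA C) -(mulrA C) ler_wpM2l// exprVn (mulrAC F).
by rewrite ler_pdivlMr ?exprn_gt0// -exprD addn2.
Qed.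

Lemma is_derive0_le_sqr f (C : R) :
  (forall y, y <= 1 -> `|f y| <= C * y ^+ 2) -> is_derive (0 : R) (1 : R) f 0.
Proof.
move=> fC; have f0 : f 0 = 0.
  by apply/normr0_eq0/le_anti; rewrite normr_ge0 (le_trans (fC _ ler01))// expr0n mulr0.
suff H : (fun h : R => h^-1 *: (f (h *: (1 : R) + 0) - f 0) : R) @ 0^' --> (0 : R).
  split; first by apply/cvg_ex; exists 0; exact: H.
  exact/cvg_lim.
apply/cvgr0Pnorm_le => e e0; near=> h.
have h0 : h != 0 by near: h; exact: nbhs_dnbhs_neq.
have h1 : `|h| < 1.
  by near: h; apply: dnbhs0_lt.
have he : `|h| < e / (`|C| + 1).
  by near: h; apply: dnbhs0_lt; rewrite divr_gt0// ltr_wpDl.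
rewrite addr0 f0 subr0 scaler1 normrM normfV ler_pdivrMl ?normr_gt0//.
rewrite (le_trans (fC _ _))//; first by rewrite ltW// (le_lt_trans (ler_norm _)).
rewrite -real_normK ?num_real// expr2 mulrA mulrC ler_wpM2l//.
rewrite (@le_trans _ _ (`|C| * `|h|))// ?ler_wpM2r ?ler_norm//.
move: he; rewrite ltr_pdivlMr ?ltr_wpDl// => /ltW; apply: le_trans.
by rewrite mulrC ler_wpM2l// lerDl.
Unshelve. all: by end_near. Qed.

(** The family is closed under differentiation: for [y > 0] the chain rule brings out [y ^- 2],
    whence ['X^2], with a plus sign from the exponential and a minus sign from [p]. At 0 the
    quadratic bound takes over. *)
Lemma is_derive_flat p y :
  is_derive y 1 (flat p) (flat ('X^2 * (p - p^`())) y).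
Proof.
have [y0|y0|->] := ltgtP y 0.
- apply: (@near_eq_is_derive _ _ _ (cst 0)).
    near=> z; rewrite /flat ltNge ifF//; apply/negbTE; rewrite negbK ltW//.
    by near: z; exact: lt_nbhsl.
  by rewrite [X in is_derive _ _ _ X]/flat ltNge (ltW y0)/=; exact: is_derive_cst.
- apply: (@near_eq_is_derive _ _ _
    ((fun z => (horner p \o (fun z => z^-1)) z) * (expR \o (fun z => - z^-1)))).
    near=> z; rewrite /flat ifT//; near: z; exact: lt_nbhsr.
  have dV : is_derive y 1 (fun z : R => z^-1) (- y ^- 2).
    have := @is_deriveV R id y 1 1; rewrite gt_eqF// /GRing.scale/= mulr1; apply => //.
  have dN : is_derive y 1 (fun z : R => - z^-1) (y ^- 2).
    have := @is_deriveN R _ _ (fun z : R => z^-1) y 1 _ dV.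
    by rewrite opprK.
  have d1 := @is_derive1_comp R (horner p) (fun z => z^-1) y _ _ (is_derive_poly p _) dV.
  have d2 := @is_derive1_comp R expR _ y _ _ (is_derive_expR _) dN.
  apply: (is_derive_eq (is_deriveM d1 d2)).
  rewrite /flat ifT//= !hornerE /GRing.scale/= exprVn.
  by ring.
- have [C C0 fC] := flat_le_sqr p.
  by rewrite [X in is_derive _ _ _ X]/flat ltxx; exact: is_derive0_le_sqr fC.
Unshelve. all: by end_near. Qed.

(* [d] lists the iterated derivatives of [h]. *)
Definition csmooth h := exists d : nat -> R -> R,
  d 0%N = h /\ forall k y, is_derive y 1 (d k) (d k.+1 y).

Lemma csmooth_flat p : csmooth (flat p).
Proof.
exists (fun k => flat (iter k (fun q => 'X^2 * (q - q^`())) p)); split=> // k y.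
exact: is_derive_flat.
Qed.

(** Needed for the weight [d - t] of the cutoff. *)
Lemma csmooth_id : csmooth id.
Proof.
exists (fun k => if k is k'.+1 then (if k' is 0%N then cst 1 else cst 0) else id).
by split=> // -[|[|k]] y; [exact: is_derive_id|exact: is_derive_cst..].
Qed.

Lemma csmooth_derive h : csmooth h ->
  exists2 h', csmooth h' & forall y, is_derive y 1 h (h' y).
Proof.
move=> [d [<- dd]]; exists (d 1%N); last exact: dd.
by exists (fun k => d k.+1); split.
Qed.

Lemma csmooth_continuous h : csmooth h -> continuous h.
Proof.
move=> /csmooth_derive[h' _ dh] y.
by apply: differentiable_continuous; apply/derivable1_diffP; case: (dh y).
Qed.

End flat_bump.

(** * A class of smooth functions stable under partial derivatives *)

Section smooth_class.
Context {R : realType} {n : nat}.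
Implicit Types (f g : 'rV[R]_n -> R) (i j : 'I_n) (x : 'rV[R]_n).

(** [smooth] quantifies over all lists of directions; a class closed under partial derivatives turns
    this into an induction on the list. The affine argument covers shifts, reflections and
    rescalings of the bumps. *)
Inductive polysmooth : ('rV[R]_n -> R) -> Prop :=
| polysmooth_coord h i (a b : R) : csmooth h ->
    polysmooth (fun x => h (a * x ord0 i + b))
| polysmooth_cst (c : R) : polysmooth (cst c)
| polysmoothD f g : polysmooth f -> polysmooth g -> polysmooth (f + g)
| polysmoothM f g : polysmooth f -> polysmooth g -> polysmooth (f * g).

(** Along the line through [x] in direction [j], [h] is composed with an affine map of slope
    [a * (i == j)%:R], and the one-variable chain rule applies. *)
Lemma is_derive_coord (h : R -> R) i j (a b dh : R) x :
  is_derive (a * x ord0 i + b) 1 h dh ->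
  is_derive x (delta_mx ord0 j) (fun x => h (a * x ord0 i + b))
    (a * (i == j)%:R * dh).
Proof.
move=> hd.
have E : (fun t : R => h (a * (t *: delta_mx ord0 j + x) ord0 i + b)) =
    h \o (fun t : R => a * (i == j)%:R * t + (a * x ord0 i + b)).
  by apply/funext => t /=; rewrite !mxE eqxx/=; congr h; ring.
have aff : is_derive (0 : R) 1
    (fun t : R => a * (i == j)%:R * t + (a * x ord0 i + b)) (a * (i == j)%:R).
  have H := is_deriveD
    (is_deriveZ (a * (i == j)%:R) (is_derive_id (0 : R) (1 : R)))
    (is_derive_cst (a * x ord0 i + b) (0 : R) (1 : R)).
  by apply: (is_derive_eq H); rewrite addr0 /GRing.scale/= mulr1.
have c0 : is_derive (0:R) 1 (h \o (fun t : R => a * (i == j)%:R * t + (a * x ord0 i + b)))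
    (dh * (a * (i == j)%:R)).
  by apply: is_derive1_comp; rewrite mulr0 add0r.
rewrite -E in c0.
have lim0 : (fun t : R => t^-1 *: (h (a * (t *: delta_mx ord0 j + x) ord0 i + b) -
    h (a * x ord0 i + b))) @ 0^' --> dh * (a * (i == j)%:R).
  have [/cvg_ex[l Hl] Dl] := c0.
  have <- : l = dh * (a * (i == j)%:R).
    by rewrite -Dl; apply/esym/cvg_lim.
  move: Hl; apply: cvg_trans; apply: near_eq_cvg; near=> t => /=.
  by rewrite addr0 /GRing.scale/= mulr1 !mxE mul0r add0r.
rewrite mulrC; split; first by apply/cvg_ex; eexists; exact: lim0.
exact/cvg_lim.
Unshelve. all: by end_near. Qed.

Lemma polysmooth_derive j f : polysmooth f -> exists2 f', polysmooth f' &
  forall x, is_derive x (delta_mx ord0 j) f (f' x).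
Proof.
elim=> {f} [h i a b|c|f g sf [f' sf' df] sg [g' sg' dg]|f g sf [f' sf' df] sg [g' sg' dg]].
- move=> /csmooth_derive[h' sh' dh].
  exists (cst (a * (i == j)%:R) * (fun x => h' (a * x ord0 i + b))).
    by apply: polysmoothM; [exact: polysmooth_cst|exact: polysmooth_coord].
  by move=> x; exact: is_derive_coord.
- by exists (cst 0); [exact: polysmooth_cst|move=> x; exact: is_derive_cst].
- by exists (f' + g'); [exact: polysmoothD|move=> x; exact: is_deriveD].
- exists (f * g' + g * f').
    by apply: polysmoothD; exact: polysmoothM.
  by move=> x; exact: is_deriveM.
Qed.

Lemma polysmooth_continuous f : polysmooth f -> continuous f.
Proof.
elim=> {f} [h i a b sh|c|f g _ cf _ cg|f g _ cf _ cg].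
- move=> x; apply: (@continuous_comp _ _ _ (fun x : 'rV[R]_n => a * x ord0 i + b) h).
    have cx : (fun y : 'rV[R]_n => y ord0 i) @ x --> x ord0 i.
      exact: coord_continuous.
    exact: cvgD (cvgM (cvg_cst a) cx) (cvg_cst b).
  exact: csmooth_continuous.
- exact: cst_continuous.
- by move=> x; exact: (cvgD (cf x) (cg x)).
- by move=> x; exact: (cvgM (cf x) (cg x)).
Qed.

Lemma polysmooth_prod (I : Type) (r : seq I) (F : I -> 'rV[R]_n -> R) :
  (forall l, polysmooth (F l)) -> polysmooth (fun x => \prod_(l <- r) F l x).
Proof.
move=> sF; elim: r => [|i r IH].
  rewrite (_ : (fun _ => _) = cst 1); first exact: polysmooth_cst.
  by apply/funext => x; rewrite big_nil.
rewrite (_ : (fun _ => _) = F i * (fun x => \prod_(l <- r) F l x)).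
  exact: polysmoothM.
by apply/funext => x; rewrite big_cons.
Qed.

Lemma polysmooth_smooth f : polysmooth f -> smooth f.
Proof.
move=> sf s.
have {}sf : polysmooth (foldr pderiv f s).
  elim: s => //= j s /(polysmooth_derive j)[g' sg' dg].
  by rewrite (_ : pderiv j _ = g')//; apply/funext => x; rewrite /pderiv; have [] := dg x.
split; first exact: polysmooth_continuous.
by move=> j x; have [g _ dg] := polysmooth_derive j sf; have [] := dg x.
Qed.

End smooth_class.

(** * Open boxes and uniqueness of measures *)

Section open_boxes.
Context {R : realType}.

Definition obox n (lo hi : 'I_n -> R) : set 'rV[R]_n :=
  [set x | forall i, lo i < x ord0 i < hi i].

Definition is_obox n : set (set 'rV[R]_n) :=
  [set A | exists lo hi, A = obox lo hi].

Lemma setI_closed_is_obox n : setI_closed (@is_obox n).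
Proof.
move=> _ _ [lo1 [hi1 ->]] [lo2 [hi2 ->]].
exists (fun i => Num.max (lo1 i) (lo2 i)), (fun i => Num.min (hi1 i) (hi2 i)).
apply/seteqP; split=> x /= => [[H1 H2]|H]; last first.
  by split=> i; have := H i; rewrite gt_max lt_min => /andP[/andP[? ?] /andP[? ?]];
    exact/andP.
move=> i; rewrite gt_max lt_min.
by have /andP[-> ->] := H1 i; have /andP[-> ->] := H2 i.
Qed.

Lemma bigcup_obox n (P : set 'rV[R]_n) (lo hi : nat -> 'I_n -> R) :
  (forall x, P x -> \forall k \near \oo, obox (lo k) (hi k) x) ->
  (forall k, obox (lo k) (hi k) `<=` P) ->
  P = \bigcup_k obox (lo k) (hi k).
Proof.
move=> Plh lhP; apply/seteqP; split=> [x /Plh[k _ Hk]|]; last exact: bigcup_sub.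
by exists k => //; apply: Hk; exact: leqnn.
Qed.

Lemma near_lt_natr (a : R) : \forall k \near \oo, - k%:R < a < k%:R.
Proof.
near=> k; rewrite -ltr_norml.
by near: k; exact: nbhs_infty_gtr.
Unshelve. all: by end_near. Qed.

Lemma near_oo_forall_ord n (P : 'I_n -> nat -> Prop) :
  (forall i, \forall k \near \oo, P i k) ->
  \forall k \near \oo, forall i, P i k.
Proof.
by move=> H; exact: filter_forall.
Qed.

Lemma setT_bigcup_obox n : [set: 'rV[R]_n] =
  \bigcup_k obox (fun=> - k%:R) (fun=> k%:R).
Proof.
apply: (bigcup_obox (lo := fun k _ => - k%:R) (hi := fun k _ => k%:R)) => //.
by move=> x _; apply: near_oo_forall_ord => i; exact: near_lt_natr.
Qed.

Lemma measurable_rV_oboxE n : @measurable _ 'rV[R]_n = <<s @is_obox n >>.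
Proof.
apply/seteqP; split=> A; last first.
  apply: smallest_sub; first exact: sigma_algebra_measurable.
  move=> _ [lo [hi ->]].
  rewrite (_ : obox _ _ = \bigcap_(i in [set: 'I_n])
      ((fun x : 'rV[R]_n => x ord0 i) @^-1` `]lo i, hi i[)); last first.
    by apply/seteqP; split=> x /= Bx i => [_|]; have := Bx i; rewrite /= in_itv/= => ->.
  apply: fin_bigcap_measurable => // i _.
  by rewrite -[X in measurable X]setTI; apply: measurable_coord_rV.
apply: smallest_sub; first exact: smallest_sigma_algebra.
case: n A => [|n] A; first by rewrite big_ord0.
rewrite -bigcup_mkord_ord; apply: bigcup_sub => i _ B [Y mY <-].
suff : measurable_fun [set: g_sigma_algebraType (@is_obox n.+1)]
    (fun x : 'rV[R]_n.+1 => x ord0 (inord i) : measurableTypeR R).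
  by move=> /(_ measurableT Y mY).
apply: (measurability _ (RGenOInfty.measurableE R)) => _ [_ [a ->] <-].
rewrite setTI.
(* The half-space where coordinate [inord i] exceeds [a] is exhausted by boxes bounded below by [a]
   in that direction and by [- k] in the others. *)
rewrite [X in measurable X](@bigcup_obox _ _ (fun k l => if l == inord i then a else - k%:R)
    (fun k _ => k%:R)).
- apply: bigcupT_measurable => k; apply: sub_sigma_algebra.
  by exists (fun l => if l == inord i then a else - k%:R), (fun=> k%:R).
- move=> x; rewrite /= in_itv/= andbT => ax; apply: near_oo_forall_ord => l.
  case: eqP => [->|_]; last exact: near_lt_natr.
  by apply: filterS (near_lt_natr (x ord0 (inord i))) => k /andP[_ ->]; rewrite ax.
- by move=> k x /= /(_ (inord i)); rewrite eqxx in_itv/= andbT => /andP[].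
Qed.

Lemma measurable_obox n (lo hi : 'I_n -> R) : measurable (obox lo hi).
Proof. by rewrite measurable_rV_oboxE; apply: sub_sigma_algebra; exists lo, hi. Qed.

(** Open boxes form a pi-system generating the Borel sets, and the cubes of half-side [k] exhaust
    the space with finite mass. This serves both the change of coordinates and the functions whose
    integral over every box is zero. *)
Lemma obox_measure_unique n (m1 m2 : {measure set 'rV[R]_n -> \bar R}) :
  (forall lo hi, m1 (obox lo hi) = m2 (obox lo hi)) ->
  (forall lo hi, m1 (obox lo hi) < +oo)%E ->
  forall A, measurable A -> m1 A = m2 A.
Proof.
move=> m12 m1oo; apply: (measure_unique (@is_obox n)
  (fun k => obox (fun=> - k%:R) (fun=> k%:R))).
- exact: measurable_rV_oboxE.
- exact: setI_closed_is_obox.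
- by move=> k; exists (fun=> - k%:R), (fun=> k%:R).
- by rewrite -setT_bigcup_obox.
- by move=> _ [lo [hi ->]].
- by move=> k; exact: m1oo.
Qed.

Lemma lebesgue_rV_obox n (lo hi : 'I_n -> R) :
  lebesgue_rV (obox lo hi) = (\prod_(i < n) lebesgue_measure `]lo i, hi i[%classic)%E.
Proof.
rewrite -lebesgue_rV_box; last by move=> i; exact: measurable_itv.
by congr lebesgue_rV; apply/seteqP; split=> x /= H i; have := H i; rewrite /= in_itv.
Qed.

Lemma lebesgue_rV_obox_lty n (lo hi : 'I_n -> R) :
  (lebesgue_rV (obox lo hi) < +oo)%E.
Proof.
rewrite lebesgue_rV_obox.
suff /fineK <- : (\prod_(i < n) lebesgue_measure `]lo i, hi i[%classic)%E
    \is a fin_num by exact: ltry.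
elim/big_ind: _ => // [x y|i _]; first exact: fin_numM.
by rewrite lebesgue_measure_itv/=; case: ifP.
Qed.

End open_boxes.

(** * Splitting off one coordinate, with a sign *)

Section insert_coordinate.
Context {R : realType} {m : nat} (j : 'I_m.+1) (b : bool).

(* The line through [x] in direction [j], run through backwards when [b]. *)
Definition rV_insert (p : measurableTypeR R * 'rV[R]_m) : 'rV[R]_m.+1 :=
  \row_i if unlift j i is Some k then p.2 ord0 k else (-1) ^+ b * p.1.

Lemma rV_insertE p : rV_insert p ord0 j = (-1) ^+ b * p.1.
Proof. by rewrite mxE unlift_none. Qed.

Lemma rV_insert_lift p i : rV_insert p ord0 (lift j i) = p.2 ord0 i.
Proof. by rewrite mxE liftK. Qed.

Lemma measurable_rV_insert : measurable_fun [set: measurableTypeR R * 'rV[R]_m] rV_insert.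
Proof.
apply: measurable_fun_rV => i; case: (unliftP j i) => [k|] ->.
  under eq_fun do rewrite rV_insert_lift.
  by apply: (measurableT_comp (measurable_coord_rV k)); exact: measurable_snd.
under eq_fun do rewrite rV_insertE.
by apply: measurable_funM => //; exact: measurable_fst.
Qed.

Lemma rV_insert_preimage_obox (lo hi : 'I_m.+1 -> R) :
  rV_insert @^-1` obox lo hi =
  (if b then `]- hi j, - lo j[%classic else `]lo j, hi j[%classic) `*`
  obox (fun i => lo (lift j i)) (fun i => hi (lift j i)).
Proof.
have E t : (if b then `]- hi j, - lo j[%classic else `]lo j, hi j[%classic) t =
    (lo j < (-1) ^+ b * t < hi j) :> Prop.
  case: b => /=; rewrite in_itv/= ?mul1r// expr1 mulN1r ltrNl ltrNr andbC//.
apply/seteqP; split=> -[t x] /=.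
  move=> H; split; first by rewrite E; have := H j; rewrite rV_insertE.
  by move=> i; have := H (lift j i); rewrite rV_insert_lift.
rewrite E => -[H1 H2] i; case: (unliftP j i) => [k|] ->.
  by rewrite rV_insert_lift.
by rewrite rV_insertE.
Qed.

(** [lebesgue_rV] is built by splitting off coordinate 0. Any coordinate, reflected or not, will do,
    since the product of the side lengths of a box ignores order and reflection. *)
Lemma lebesgue_rV_insert A : measurable A ->
  lebesgue_rV A = (lebesgue_measure \x lebesgue_rV)%E (rV_insert @^-1` A).
Proof.
move: A; pose nu0 : {measure set _ -> \bar R} := pushforward
  (lebesgue_measure \x lebesgue_rV)%E rV_insert.
pose nu := nu0 measurable_rV_insert.
suff: forall A, measurable A -> lebesgue_rV A = nu A by exact.
apply: obox_measure_unique => [lo hi|lo hi]; last exact: lebesgue_rV_obox_lty.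
have -> : nu (obox lo hi) =
  (lebesgue_measure \x lebesgue_rV)%E (rV_insert @^-1` obox lo hi) by [].
rewrite rV_insert_preimage_obox product_measure1E; last 2 first.
- by case: b; exact: measurable_itv.
- exact: measurable_obox.
rewrite [LHS]lebesgue_rV_obox.
rewrite [X in (_ * X)%E]lebesgue_rV_obox (bigD1_ord j)//; congr (_ * _)%E.
case: b; last by [].
rewrite [LHS]lebesgue_measure_itv [RHS]lebesgue_measure_itv/= !lte_fin ltrN2.
by case: ifP => // _; rewrite -!EFinB opprK addrC.
Qed.

End insert_coordinate.

(** * Change of variables for integrals *)

Section integral_insert.
Context {R : realType} {m : nat} (j : 'I_m.+1) (b : bool).
Local Notation e := (@rV_insert R m j b).
Local Notation mu := (@lebesgue_rV R m.+1).
Local Notation nu := (@lebesgue_measure R \x @lebesgue_rV R m)%E.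

Lemma ae_rV_insert (P : 'rV[R]_m.+1 -> Prop) :
  (\forall x \ae mu, P x) -> \forall p \ae nu, P (e p).
Proof.
move=> [N [mN N0 PN]]; exists (e @^-1` N); split.
- by rewrite -[X in measurable X]setTI; exact: measurable_rV_insert.
- by rewrite -lebesgue_rV_insert.
- by move=> p /= nP; apply: PN.
Qed.

Let eq_integral_rV_insert (D : set 'rV[R]_m.+1) (f : 'rV[R]_m.+1 -> \bar R) :
  (\int[mu]_(x in D) f x = \int[pushforward nu e]_(x in D) f x)%E.
Proof.
apply: eq_measure_integral; first exact: measurable_rV_insert.
by move=> me A mA _; exact: lebesgue_rV_insert.
Qed.

Lemma integrable_rV_insert (D : set 'rV[R]_m.+1) (f : 'rV[R]_m.+1 -> \bar R) :
  measurable D -> mu.-integrable D f -> nu.-integrable (e @^-1` D) (f \o e).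
Proof.
move=> mD /integrableP[mf fi].
have mE : measurable (e @^-1` D).
  by rewrite -[X in measurable X]setTI; exact: measurable_rV_insert.
have me : measurable_fun (e @^-1` D) e by apply: measurable_funTS; exact: measurable_rV_insert.
have mfe : measurable_fun (e @^-1` D) (f \o e).
  by apply: (measurable_comp mD) => // _ [x Dx <-].
apply/integrableP; split => //.
suff <- : (\int[mu]_(x in D) `|f x| = \int[nu]_(p in e @^-1` D) `|f (e p)|)%E by [].
apply: etrans (ge0_integral_pushforward (@measurable_rV_insert R m j b) nu mD
  (f := abse \o f) _ _).
- exact: (eq_integral_rV_insert D (abse \o f)).
- exact: measurableT_comp.
- by move=> *; exact: abse_ge0.
Qed.

Lemma integral_rV_insert (D : set 'rV[R]_m.+1) (f : 'rV[R]_m.+1 -> \bar R) :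
  measurable D -> mu.-integrable D f ->
  (\int[mu]_(x in D) f x = \int[nu]_(p in e @^-1` D) f (e p))%E.
Proof.
move=> mD fi; have mf := measurable_int _ fi.
have mE : measurable (e @^-1` D).
  by rewrite -[X in measurable X]setTI; exact: measurable_rV_insert.
rewrite integral_mkcond [RHS]integral_mkcond.
have mfD : measurable_fun setT (f \_ D) by exact/(measurable_restrictT _ mD).
have := integral_pushforward (@measurable_rV_insert R m j b) (mu := nu) (D := setT) mfD.
rewrite preimage_setT => <-//.
- have -> : (f \_ D) \o e = (f \o e) \_ (e @^-1` D) by [].
  apply/(integrable_mkcond _ mE).
  exact: integrable_rV_insert.
Qed.

End integral_insert.

(** * Almost everywhere reasoning *)

Section ae_filter.
Context d (T : measurableType d) {R : realType} (mu : {measure set T -> \bar R}).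
Implicit Types P Q S : T -> Prop.

Lemma ae_mono P Q : (forall x, P x -> Q x) ->
  (\forall x \ae mu, P x) -> \forall x \ae mu, Q x.
Proof. exact: (@filterS _ _ (ae_filter_ringOfSetsType mu)). Qed.

Lemma ae_mono2 P Q S : (forall x, P x -> Q x -> S x) ->
  (\forall x \ae mu, P x) -> (\forall x \ae mu, Q x) -> \forall x \ae mu, S x.
Proof. exact: (@filterS2 _ _ (ae_filter_ringOfSetsType mu)). Qed.

Lemma ae_mono3 P Q S W : (forall x, P x -> Q x -> S x -> W x) ->
  (\forall x \ae mu, P x) -> (\forall x \ae mu, Q x) ->
  (\forall x \ae mu, S x) -> \forall x \ae mu, W x.
Proof. exact: (@filterS3 _ _ (ae_filter_ringOfSetsType mu)). Qed.

Lemma ae_forall_fin (I : finType) (P : I -> T -> Prop) :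
  (forall i, \forall x \ae mu, P i x) -> \forall x \ae mu, forall i, P i x.
Proof. exact: (@filter_forall _ _ _ _ (ae_filter_ringOfSetsType mu)). Qed.

(** Used for rational end points on lines and for boxes with rational corners. *)
Lemma ae_forall_count (I : countType) (P : I -> T -> Prop) :
  (forall i, \forall x \ae mu, P i x) -> \forall x \ae mu, forall i, P i x.
Proof.
move=> H; have /ae_foralln : forall n, \forall x \ae mu,
    if unpickle n is Some i then P i x else True.
  by move=> n; case: unpickle => [i|]; [exact: H|exact: aeW].
by apply: ae_mono => x Hx i; have := Hx (pickle i); rewrite pickleK.
Qed.

End ae_filter.

(** * Gronwall's lemma with an integrable coefficient *)

Section gronwall.
Context {R : realType}.
Local Notation mu := (@lebesgue_measure R).
Implicit Types (f g K : R -> R) (a b : R).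
Local Notation integrableT f := (mu.-integrable setT (EFin \o f)).

Lemma integrableT_sub f (A : set R) : measurable A -> integrableT f ->
  mu.-integrable A (EFin \o f).
Proof. by move=> mA; apply: integrableS. Qed.

Lemma integrableT_sum (I : finType) (f : I -> R -> R) :
  (forall i, integrableT (f i)) -> integrableT (fun t => \sum_i f i t).
Proof.
move=> fi; rewrite (_ : EFin \o _ = fun t => (\sum_i (f i t)%:E)%E).
  by apply: integrable_sum => // i _; exact: fi.
by apply/funext => t /=; rewrite sumEFin.
Qed.

Lemma integrableT_norm f : integrableT f -> integrableT (fun t => `|f t|).
Proof. by move=> /integrable_norm. Qed.

Section gronwall_zero.
Variables (a b : R) (g K : R -> R).
Hypotheses (gi : integrableT g) (Ki : integrableT K).
Hypotheses (g0 : forall t, 0 <= g t) (K0 : forall t, 0 <= K t).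
Hypothesis gK : \forall t \ae mu, a < t < b ->
  g t <= K t * \int[mu]_(s in `[a, t]) g s.

(* Absolute continuity gives a step [d] over which [K] has integral less than 1;
   the primitive of [g] then stays zero over each successive step of size [d / 2]. *)
Lemma gronwall_integral_eq0 y : a <= y < b -> \int[mu]_(s in `[a, y]) g s = 0.
Proof.
have [d [d0 Hd]] := integral_normr_continuous Ki (@ltr01 R).
have d20 : 0 < d / 2 by exact: divr_gt0.
suff H n : forall z, a <= z < b -> z <= a + n%:R * (d / 2) ->
    \int[mu]_(s in `[a, z]) g s = 0.
  move=> yab; have [n] : exists n, (y - a) / (d / 2) < n%:R.
    by eexists; exact: truncnS_gt.
  by rewrite ltr_pdivrMr// ltrBlDl => /ltW; exact: H.
elim: n => [|n IH] z /andP[az zb].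
  rewrite mul0r addr0 => za; rewrite (_ : z = a) ?set_itv1 ?Rintegral_set1//.
  by apply/eqP; rewrite eq_le za az.
move=> zn; pose c := Num.max a (z - d / 2).
have ac : a <= c by rewrite le_max lexx.
have cz : c <= z by rewrite ge_max az gerBl ltW.
have c0 : \int[mu]_(s in `[a, c]) g s = 0.
  apply: IH; first by rewrite ac (le_lt_trans cz).
  rewrite ge_max; apply/andP; split; first by rewrite lerDl mulr_ge0// ltW.
  rewrite lerBlDr (le_trans zn)//.
  by rewrite -addrA -[in leLHS]natr1 mulrDl mul1r.
have IE : \int[mu]_(s in `[a, z]) g s = \int[mu]_(s in `]c, z]) g s.
  rewrite -[LHS]subr0 -c0 Rintegral_itvB//; exact: integrableT_sub.
rewrite IE; set I := Rintegral _ _ _.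
have I0 : 0 <= I by exact: Rintegral_ge0.
have k1 : \int[mu]_(s in `]c, z]) K s < 1.
  rewrite (_ : \int[mu]_(s in `]c, z]) K s = \int[mu]_(s in `]c, z]) `|K s|).
    apply: Hd => //; rewrite [X in (X < _)%E]lebesgue_measure_itv/= lte_fin; case: ifPn => _.
      rewrite -EFinB lte_fin ltrBlDr -ltrBlDl.
      rewrite lt_max; apply/orP; right.
      by rewrite ltrD2l ltrN2 ltr_pdivrMr// ltr_pMr// ltr1n.
    by rewrite lte_fin.
  by apply: eq_Rintegral => s _; rewrite ger0_norm.
(* On []c, z]] the inner integral is at most [I], so [I] is bounded by itself times a factor smaller
   than 1. *)
have Ile : I <= I * \int[mu]_(s in `]c, z]) K s.
  rewrite -RintegralZl//; last by apply: integrableT_sub.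
  rewrite /I fine_le//.
  - by apply: integrable_fin_num => //; apply: integrableT_sub.
  - apply: integrable_fin_num => //.
    rewrite (_ : (fun _ => _) = fun s => (I%:E * (EFin \o K) s)%E)//.
    by apply: integrableZl => //; exact: integrableT_sub.
  apply: ae_ge0_le_integral => //.
  - by move=> s _; rewrite lee_fin.
  - by apply: measurable_int; apply: integrableT_sub gi.
  - by move=> s _; rewrite lee_fin mulr_ge0.
  - apply/measurable_EFinP; apply: measurable_funM => //.
    by apply/measurable_EFinP; apply: measurable_int; apply: integrableT_sub Ki.
  apply: ae_mono gK => s Hs; rewrite /= in_itv/= => /andP[cs sz].
  have as_ : a < s by exact: le_lt_trans cs.
  rewrite lee_fin (le_trans (Hs _))//; first by rewrite as_ (le_lt_trans sz).
  rewrite mulrC ler_wpM2r// /I -IE.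
  rewrite -lee_fin !fineK; last 2 first.
  - by apply: integrable_fin_num => //; apply: integrableT_sub.
  - by apply: integrable_fin_num => //; apply: integrableT_sub.
  apply: ge0_subset_integral => //.
  - by apply: measurable_int; apply: integrableT_sub gi.
  - by move=> t _; rewrite lee_fin.
  - by apply: subset_itvl; rewrite bnd_simp.
apply/eqP; rewrite eq_le I0 andbT leNgt; apply/negP => Ip.
by move: Ile; rewrite leNgt gtr_pMr// k1.
Qed.

End gronwall_zero.

Lemma continuous_integral f a b y : integrableT f -> a < y < b ->
  {for y, continuous (fun z => \int[mu]_(s in `[a, z]) f s)}.
Proof.
move=> fi /andP[ay yb]; have ab := lt_trans ay yb.
have /(continuous_within_itvP _ ab)[+ _ _] :=
  parameterized_integral_continuous (ltW ab) (integrableT_sub (measurable_itv _) fi).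
by apply; rewrite in_itv/= ay.
Qed.

Lemma eq0_ratr (E : R -> R) a b : {in `]a, b[, continuous E} ->
  (forall q : rat, a < ratr q < b -> E (ratr q) = 0) ->
  forall y, a < y < b -> E y = 0.
Proof.
move=> cE Eq y yab; apply: contrapT => /eqP Ey; have /andP[ay yb] := yab.
have cEy : E @ y --> E y by apply: cE; rewrite in_itv.
have : \forall z \near y, a < z < b /\ E z != 0.
  near=> z; split; last by near: z; exact: cvgr_neq0 cEy Ey.
  by apply/andP; split; near: z; [exact: lt_nbhsr|exact: lt_nbhsl].
move=> /nbhs_ballP[e /= e0 He].
have [q] := rat_in_itvoo (ltr_pwDr e0 (lexx y)).
rewrite in_itv/= => /andP[yq qe].
have [] := He (ratr q).
  by rewrite /ball/= ltr0_norm ?subr_lt0// opprB ltrBlDl.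
by move=> /Eq ->; rewrite eqxx.
Unshelve. all: by end_near. Qed.

Lemma is_derive_integral f a : integrableT f ->
  \forall y \ae mu, a < y ->
    is_derive y (1 : R) (fun z => \int[mu]_(s in `[a, z]) f s) (f y).
Proof.
move=> fi; have := @FTC1 R f (BLeft a).
move=> /(_ (fun y => integrableT_sub (measurable_itv _) fi)).
move=> /(_ (open_integrable_locally openT fi)).
apply: ae_mono => y H ay; have [|dF EF] := H; first by rewrite lte_fin.
by split; [exact: dF|rewrite -derive1E; exact: EF].
Qed.

(** With [F], [G], [H] the primitives of [f], [g] and [t * g t], the hypothesis reads [F = y G - H]
    at rational points. Continuity extends it to all of them, and in the derivative, which exists
    almost everywhere, the two terms [y * g y] cancel. *)
Lemma gronwall_primitive (f g : R -> R) a b :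
  integrableT f -> integrableT g -> integrableT (fun t => t * g t) ->
  (forall q : rat, a < ratr q < b -> \int[mu]_(t in `[a, ratr q]) f t =
    ratr q * \int[mu]_(t in `[a, ratr q]) g t -
    \int[mu]_(t in `[a, ratr q]) (t * g t)) ->
  \forall y \ae mu, a < y < b -> f y = \int[mu]_(t in `[a, y]) g t.
Proof.
move=> fi gi tgi fg.
pose F y := \int[mu]_(t in `[a, y]) f t.
pose G y := \int[mu]_(t in `[a, y]) g t.
pose H y := \int[mu]_(t in `[a, y]) (t * g t).
have FE y : a < y < b -> F y = y * G y - H y.
  move=> yab; apply/eqP; rewrite -subr_eq0; apply/eqP.
  apply: (@eq0_ratr (fun y => F y - (y * G y - H y)) a b) => //.
    move=> z; rewrite in_itv/= => zab.
    have cF : F @ z --> F z by exact: continuous_integral zab.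
    have cG : G @ z --> G z by exact: continuous_integral zab.
    have cH : H @ z --> H z by exact: continuous_integral zab.
    exact: cvgB cF (cvgB (cvgM cvg_id cG) cH).
  by move=> q qab; rewrite /F fg// subrr.
have dF := is_derive_integral a fi; have dG := is_derive_integral a gi.
have dH := is_derive_integral a tgi.
move: dF dG dH; apply: ae_mono3 => y dF dG dH /andP[ay yb].
have {}dF := dF ay; have {}dG := dG ay; have {}dH := dH ay.
have D : is_derive y (1 : R) (fun z => z * G z - H z) (G y).
  apply: (is_derive_eq (is_deriveB (is_deriveM (is_derive_id y (1 : R)) dG) dH)).
  by rewrite /GRing.scale/= mulr1 [X in X - _]addrC addrK.
have D' : is_derive y (1 : R) F (G y).
  apply: near_eq_is_derive D; near=> z; rewrite FE//.
  by apply/andP; split; near: z; [exact: lt_nbhsr|exact: lt_nbhsl].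
have [_ <-] := dF; by have [_ ->] := D'.
Unshelve. all: by end_near. Qed.

Lemma gronwall_system (M : nat) (f g : 'I_M -> R -> R) (W : R -> R) a b :
  (forall k, integrableT (f k)) -> (forall k, integrableT (g k)) ->
  (forall k, integrableT (fun t => t * g k t)) -> integrableT W ->
  (forall k (q : rat), a < ratr q < b -> \int[mu]_(t in `[a, ratr q]) f k t =
    ratr q * \int[mu]_(t in `[a, ratr q]) g k t -
    \int[mu]_(t in `[a, ratr q]) (t * g k t)) ->
  (\forall t \ae mu, a < t < b -> forall k, `|g k t| <= W t * \sum_l `|f l t|) ->
  \forall t \ae mu, a < t < b -> forall k, f k t = 0.
Proof.
move=> fi gi tgi Wi fg gW.
(* Gronwall is run on the derivatives rather than on [f]: the primitive of [h] dominates every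
   [|f k|] at once, which bounds [h] by its own primitive. *)
pose h t := \sum_k `|g k t|.
have hi : integrableT h by apply: integrableT_sum => k; exact: integrableT_norm.
have h0 t : 0 <= h t by exact: sumr_ge0.
have fh : \forall t \ae mu, a < t < b ->
    forall k, `|f k t| <= \int[mu]_(s in `[a, t]) h s.
  have : \forall t \ae mu, forall k, a < t < b -> f k t = \int[mu]_(s in `[a, t]) g k s.
    by apply: ae_forall_fin => k;
      exact: gronwall_primitive (fi k) (gi k) (tgi k) (fg k).
  apply: ae_mono => t Ht tab k; rewrite Ht//.
  apply: (le_trans (le_normr_Rintegral _ _)) => //; first exact: integrableT_sub.
  apply: le_Rintegral => //.
  - by apply: integrableT_sub => //; exact: integrableT_norm.
  - exact: integrableT_sub.
  - by move=> s _; rewrite /h (bigD1 k)//= lerDl sumr_ge0.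
(* One factor [M] counts the summands of [h], the other the summands bounding each of them; the
   absolute value makes the coefficient nonnegative. *)
pose K t := M%:R ^+ 2 * `|W t|.
have Ki : integrableT K.
  rewrite (_ : EFin \o K = fun s => ((M%:R ^+ 2)%:E * (EFin \o (fun t => `|W t|)%R) s)%E)//.
  by apply: integrableZl => //; exact: integrableT_norm.
have hK : \forall t \ae mu, a < t < b -> h t <= K t * \int[mu]_(s in `[a, t]) h s.
  move: fh gW; apply: ae_mono2 => t ft gt tab.
  have {gt} := gt tab; have {ft} := ft tab.
  move: (\int[mu]_(s in `[a, t]) h s) => I fI gt.
  have -> : K t * I = \sum_(k < M) (`|W t| * (\sum_(l < M) I)).
    rewrite !sumr_const card_ord /K -(mulr_natl I) -(mulr_natl (_ * _)) expr2.
    by rewrite -!mulrA; congr (_ * _); rewrite mulrCA.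
  apply: ler_sum => k _; apply: (le_trans (gt k)).
  apply: (@le_trans _ _ (`|W t| * \sum_(l < M) `|f l t|)).
    by rewrite ler_wpM2r ?ler_norm// sumr_ge0.
  by rewrite ler_wpM2l// ler_sum// => l _; exact: fI.
move: fh; apply: ae_mono => t ft tab k; apply/normr0_eq0/le_anti.
rewrite normr_ge0 andbT (le_trans (ft tab k))//.
rewrite (gronwall_integral_eq0 hi Ki h0 _ hK)//.
- by move=> s; rewrite mulr_ge0.
- by case/andP: tab => /ltW -> ->.
Qed.

End gronwall.

(** * One-dimensional cutoffs *)

Section cutoff.
Context {R : realType}.
Implicit Types (k y t a d : R).

(** For [y > 0] this is [exp(-1/(k y))], which tends to 1 as [k] grows: a smooth approximation of
    the indicator of the half-line. *)
Definition expbump k y : R := flat 1 (k * y).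
Definition dexpbump k y : R := k * flat ('X^2 * (1 - 1^`())) (k * y).

Lemma expbump_le0 k y : 0 < k -> y <= 0 -> expbump k y = 0.
Proof. by move=> k0 y0; rewrite /expbump /flat pmulr_rgt0// ltNge y0. Qed.

Lemma dexpbump_le0 k y : 0 < k -> y <= 0 -> dexpbump k y = 0.
Proof. by move=> k0 y0; rewrite /dexpbump /flat pmulr_rgt0// ltNge y0/= mulr0. Qed.

Lemma expbump_gt0E k y : 0 < k -> 0 < y -> expbump k y = expR (- (k * y)^-1).
Proof. by move=> k0 y0; rewrite /expbump /flat mulr_gt0// hornerC mul1r. Qed.

Lemma dexpbump_gt0E k y : 0 < k -> 0 < y ->
  dexpbump k y = (k * y ^+ 2)^-1 * expR (- (k * y)^-1).
Proof.
move=> k0 y0; rewrite /dexpbump /flat mulr_gt0// derivC subr0 mulr1 hornerXn mulrA.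
congr (_ * _); rewrite exprVn exprMn.
by field; rewrite !gt_eqF.
Qed.

Lemma expbump_ge0 k y : 0 <= expbump k y.
Proof. by rewrite /expbump /flat; case: ifP => // _; rewrite hornerC mul1r expR_ge0. Qed.

Lemma expbump_le1 k y : expbump k y <= 1.
Proof.
rewrite /expbump /flat; case: ifPn => // ky.
by rewrite hornerC mul1r -expR0 ler_expR oppr_le0 invr_ge0 ltW.
Qed.

Lemma dexpbump_ge0 k y : 0 < k -> 0 <= dexpbump k y.
Proof.
move=> k0; have [y0|y0] := leP y 0; first by rewrite dexpbump_le0.
by rewrite dexpbump_gt0E// mulr_ge0 ?expR_ge0// invr_ge0 mulr_ge0 ?sqr_ge0// ltW.
Qed.

Lemma dexpbump_le k y : 0 < k -> 0 < y -> dexpbump k y <= (k * y ^+ 2)^-1.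
Proof.
move=> k0 y0; rewrite dexpbump_gt0E// -[leRHS]mulr1 ler_wpM2l//.
  by rewrite invr_ge0 mulr_ge0 ?sqr_ge0// ltW.
by rewrite -expR0 ler_expR oppr_le0 invr_ge0 mulr_ge0// ltW.
Qed.

(** The product is [z exp(-z)] with [z = 1/(k y)], hence bounded uniformly in [k]. Thus the weight
    [d - t] compensates the steepness of the cutoff at its upper end. *)
Lemma mul_dexpbump_le1 k y : 0 < k -> 0 <= y -> y * dexpbump k y <= 1.
Proof.
move=> k0; rewrite le_eqVlt => /predU1P[<-|y0]; first by rewrite mul0r.
rewrite dexpbump_gt0E// mulrA (_ : y * _ = (k * y)^-1); last first.
  by field; rewrite !gt_eqF.
rewrite expRN ler_pdivrMr ?expR_gt0// mul1r.
by apply: le_trans (expR_ge1Dx _); rewrite lerDr.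
Qed.

Lemma cvg_expbump y : 0 < y -> (expbump k.+1%:R y : R) @[k --> \oo] --> (1 : R).
Proof.
move=> y0; rewrite -[X in _ --> X]expR0 -[X in expR X]oppr0.
have -> : (fun k : nat => expbump k.+1%:R y) =
    (fun k : nat => expR (- (y^-1 * k.+1%:R^-1))).
  by apply/funext => k; rewrite expbump_gt0E// invfM mulrC.
have c : (fun k : nat => - (y^-1 * k.+1%:R^-1)) @ \oo --> - (0 : R).
  apply: cvgN; rewrite -[X in _ --> X](mulr0 y^-1).
  by apply: cvgM; [exact: cvg_cst|exact: cvg_harmonic].
exact: (cvg_comp _ _ c (@continuous_expR R (- 0))).
Qed.

Lemma cvg_dexpbump y : 0 < y -> (dexpbump k.+1%:R y : R) @[k --> \oo] --> (0 : R).
Proof.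
move=> y0.
have c : (fun k : nat => (y ^+ 2)^-1 * k.+1%:R^-1) @ \oo --> (0 : R).
  rewrite -[X in _ --> X](mulr0 (y ^+ 2)^-1).
  by apply: cvgM; [exact: cvg_cst|exact: cvg_harmonic].
have c0 : (fun _ : nat => 0 : R) @ \oo --> (0 : R) by exact: cvg_cst.
apply: squeeze_cvgr c0 c; apply: nearW => k.
rewrite dexpbump_ge0//= (le_trans (dexpbump_le _ _))//.
by rewrite invfM mulrC.
Qed.

Lemma is_derive_expbump k (s c t : R) :
  is_derive t (1 : R) (fun t => expbump k (s * t + c)) (s * dexpbump k (s * t + c)).
Proof.
have H := is_deriveD (is_deriveZ s (is_derive_id t (1 : R)))
  (is_derive_cst c t (1 : R)).
have {}H : is_derive t (1 : R) (fun t => k * (s * t + c)) (k * s).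
  have H' := is_deriveZ k H.
  by apply: (is_derive_eq H'); rewrite addr0 /GRing.scale/= mulr1.
have D := @is_derive1_comp R (flat 1) (fun t => k * (s * t + c)) t _ _
  (is_derive_flat 1 _) H.
by apply: (is_derive_eq D); rewrite /dexpbump [RHS]mulrCA mulrC -mulrA.
Qed.

(** Approximates [d - t] times the indicator of []a, d[]. Its derivative [dcutoff] tends to -1
    inside the interval. *)
Definition cutoff k a d t : R := expbump k (t - a) * ((d - t) * expbump k (d - t)).

Definition dcutoff k a d t : R :=
  expbump k (t - a) * (- expbump k (d - t) - (d - t) * dexpbump k (d - t)) +
  (d - t) * expbump k (d - t) * dexpbump k (t - a).

Lemma is_derive_cutoff k a d t :
  is_derive t (1 : R) (cutoff k a d) (dcutoff k a d t).
Proof.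
have dA := is_derive_expbump k 1 (- a) t; have dC := is_derive_expbump k (-1) d t.
have dB := is_deriveD (is_deriveZ (-1) (is_derive_id t (1 : R)))
  (is_derive_cst d t (1 : R)).
rewrite (_ : cutoff k a d = (fun t => expbump k (1 * t - a)) *
  ((fun t => -1 * t + d) * (fun t => expbump k (-1 * t + d)))); last first.
  apply/funext => u; rewrite /cutoff !fctE mul1r mulN1r (addrC (- u)).
  by [].
apply: (is_derive_eq (is_deriveM dA (is_deriveM dB dC))).
rewrite /dcutoff !fctE /GRing.scale/= !mul1r !mulN1r scaleN1r (addrC (- t)).
move: (expbump k _) (expbump k _) (dexpbump k _) (dexpbump k _) => p q r s.
by ring.
Qed.

Lemma cutoff_eq0 k a d t : 0 < k -> ~~ (a < t < d) -> cutoff k a d t = 0.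
Proof.
move=> k0; rewrite negb_and -!leNgt => /orP[ta|dt]; rewrite /cutoff.
  by rewrite expbump_le0 ?mul0r// subr_le0.
by rewrite [expbump k (d - t)]expbump_le0 ?mulr0// subr_le0.
Qed.

Lemma dcutoff_eq0 k a d t : 0 < k -> ~~ (a < t < d) -> dcutoff k a d t = 0.
Proof.
move=> k0; rewrite negb_and -!leNgt => /orP[ta|dt]; rewrite /dcutoff.
  rewrite [expbump k (t - a)]expbump_le0 ?[dexpbump k (t - a)]dexpbump_le0 ?subr_le0//.
  by rewrite mul0r mulr0 addr0.
rewrite [expbump k (d - t)]expbump_le0 ?[dexpbump k (d - t)]dexpbump_le0 ?subr_le0//.
by rewrite !mulr0 mul0r subr0 oppr0 mulr0 addr0.
Qed.

Lemma cutoff_bound k a d t : a < t < d -> `|cutoff k a d t| <= d - a.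
Proof.
move=> /andP[at_ td]; have dt0 : 0 <= d - t by rewrite subr_ge0 ltW.
rewrite ger0_norm; last by rewrite !mulr_ge0 ?expbump_ge0.
rewrite -[leRHS]mul1r ler_pM ?expbump_ge0 ?expbump_le1 ?mulr_ge0 ?expbump_ge0//.
rewrite -[leRHS]mulr1 ler_pM ?expbump_ge0 ?expbump_le1//.
by rewrite lerD2l lerN2 ltW.
Qed.

(** The 2 comes from the upper bump and from [mul_dexpbump_le1], each at most 1. The quotient bounds
    the weight, at most [d - a], times the derivative of the lower bump, at most [1/(k (t - a)^2)];
    it is uniform in [k] because [t] keeps the distance [a1 - a] from [a]. *)
Lemma dcutoff_bound k a a1 d t : 1 <= k -> a < a1 -> a1 <= t < d ->
  `|dcutoff k a d t| <= 2 + (d - a) / (a1 - a) ^+ 2.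
Proof.
move=> k1 aa1 /andP[at_ td]; have k0 : 0 < k by exact: lt_le_trans k1.
have dt0 : 0 <= d - t by rewrite subr_ge0 ltW.
have a1a0 : 0 < a1 - a by rewrite subr_gt0.
have ta0 : 0 < t - a by rewrite subr_gt0 (lt_le_trans aa1).
rewrite (le_trans (ler_normD _ _))// lerD//.
  rewrite normrM -[leRHS]mul1r ler_pM//.
    by rewrite ger0_norm ?expbump_ge0// expbump_le1.
  rewrite (le_trans (ler_normB _ _))// normrN -[2]/(1 + 1) lerD//.
    by rewrite ger0_norm ?expbump_ge0// expbump_le1.
  by rewrite ger0_norm ?mul_dexpbump_le1// mulr_ge0// dexpbump_ge0.
have db0 : 0 <= (d - t) * expbump k (d - t) by rewrite mulr_ge0 ?expbump_ge0.
have q0 := dexpbump_ge0 (t - a) k0.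
rewrite ger0_norm; last exact: mulr_ge0.
apply: ler_pM => //.
  rewrite -[leRHS]mulr1 ler_pM ?expbump_ge0 ?expbump_le1//.
  by rewrite lerD2l lerN2 ltW// (lt_le_trans aa1).
rewrite (le_trans (dexpbump_le _ _))// lef_pV2 ?posrE ?mulr_gt0 ?exprn_gt0//.
rewrite -[leLHS]mul1r ler_pM ?sqr_ge0//.
by rewrite lerXn2r ?nnegrE ?(ltW a1a0) ?(ltW ta0)// lerD2r.
Qed.

Lemma cvg_cutoff a d t : a < t < d ->
  (cutoff k.+1%:R a d t : R) @[k --> \oo] --> d - t.
Proof.
move=> /andP[at_ td].
have c1 : (expbump k.+1%:R (t - a) : R) @[k --> \oo] --> (1 : R).
  by apply: cvg_expbump; rewrite subr_gt0.
have c2 : (expbump k.+1%:R (d - t) : R) @[k --> \oo] --> (1 : R).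
  by apply: cvg_expbump; rewrite subr_gt0.
have c3 : (fun _ : nat => d - t) @ \oo --> d - t by exact: cvg_cst.
have := cvgM c1 (cvgM c3 c2); rewrite mul1r mulr1; exact.
Qed.

Lemma cvg_dcutoff a d t : a < t < d ->
  (dcutoff k.+1%:R a d t : R) @[k --> \oo] --> (-1 : R).
Proof.
move=> /andP[at_ td].
have c1 : (expbump k.+1%:R (t - a) : R) @[k --> \oo] --> (1 : R).
  by apply: cvg_expbump; rewrite subr_gt0.
have c2 : (expbump k.+1%:R (d - t) : R) @[k --> \oo] --> (1 : R).
  by apply: cvg_expbump; rewrite subr_gt0.
have c3 : (dexpbump k.+1%:R (t - a) : R) @[k --> \oo] --> (0 : R).
  by apply: cvg_dexpbump; rewrite subr_gt0.
have c4 : (dexpbump k.+1%:R (d - t) : R) @[k --> \oo] --> (0 : R).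
  by apply: cvg_dexpbump; rewrite subr_gt0.
have c5 : (fun _ : nat => d - t) @ \oo --> d - t by exact: cvg_cst.
have := cvgD (cvgM c1 (cvgB (cvgN c2) (cvgM c5 c4))) (cvgM (cvgM c5 c2) c3).
by rewrite !mulr0 subr0 addr0 mul1r; exact.
Qed.

End cutoff.

Lemma polysmooth_expbump (R : realType) n (k p c : R) (i : 'I_n)
    (f : 'rV[R]_n -> R) : (forall x, f x = p * x ord0 i + c) ->
  polysmooth (fun x : 'rV[R]_n => expbump k (f x)).
Proof.
move=> fE; rewrite (_ : (fun x : 'rV[R]_n => _) =
  fun x : 'rV[R]_n => flat 1 (k * p * x ord0 i + k * c)).
  by apply: polysmooth_coord; exact: csmooth_flat.
by apply/funext => x; rewrite fE /expbump mulrDr mulrA.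
Qed.

(** * Closed boxes and local integrability *)

Section closed_boxes.
Context {R : realType} {n : nat}.
Implicit Types (L H : 'I_n -> R) (f : 'rV[R]_n -> R) (K Omega : set 'rV[R]_n).

Definition cbox L H : set 'rV[R]_n := [set x | forall i, L i <= x ord0 i <= H i].

Lemma obox_cbox L H : obox L H `<=` cbox L H.
Proof. by move=> x xLH i; have /andP[/ltW -> /ltW ->] := xLH i. Qed.

Lemma compact_cbox L H : compact (cbox L H).
Proof.
have := @rV_compact R n (fun i => `[L i, H i]%classic) (fun i => @segment_compact R _ _).
rewrite (_ : [set _ | _] = cbox L H); first exact.
by apply/seteqP; split=> x Hx i; have := Hx i; rewrite /= in_itv.
Qed.

Lemma compact_measurable_rV K : compact K -> measurable K.
Proof.
move=> /compact_closed cK; rewrite -[K]setCK; apply: measurableC.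
apply: open_measurable_rV; apply: closed_openC; apply: cK.
exact: norm_hausdorff.
Qed.

Lemma continuous_measurable_rV f : continuous f -> measurable_fun setT f.
Proof.
move=> cf; apply: (measurability _ (RGenOpens.measurableE R)).
move=> _ [_ [a [b ->] <-]]; rewrite setTI; apply: open_measurable_rV.
by apply: open_comp; [move=> x _; exact: cf|exact: interval_open].
Qed.

Lemma Lploc1_integrable Omega f K : Lploc 1 Omega f -> open Omega ->
  compact K -> K `<=` Omega -> lebesgue_rV.-integrable K (EFin \o f).
Proof.
move=> [mf fK] oO cK KO; apply/integrableP; split.
  apply/measurable_EFinP; apply: measurable_funS mf => //.
  exact: open_measurable_rV.
by apply: le_lt_trans (fK K cK KO).
Qed.

End closed_boxes.

(** * Test functions supported in a box *)

Section box_test_function.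
Context {R : realType} {m : nat} (j : 'I_m.+1) (b : bool) (L H : 'I_m.+1 -> R).
Local Notation s := ((-1) ^+ b : R).
Implicit Types (k : R) (x : 'rV[R]_m.+1).

(** The lower end of the range of [s * x ord0 j] over the open box; [box_end] is the upper one. *)
Definition box_start : R := if b then - H j else L j.
Definition box_end : R := if b then - L j else H j.
Local Notation a := box_start.
Local Notation d := box_end.

Lemma oboxE x : obox L H x <-> a < s * x ord0 j < d /\
  forall i, L (lift j i) < x ord0 (lift j i) < H (lift j i).
Proof.
rewrite /box_start /box_end; split=> [xLH|[xj xi] i].
  split=> [|i]; last exact: xLH.
  have /andP[] := xLH j; case: b => Lx xH.
    by rewrite expr1 mulN1r !ltrN2 xH.
  by rewrite expr0 mul1r Lx.
case: (unliftP j i) => [l ->|->]; first exact: xi.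
by move: xj; case: b; rewrite ?expr0 ?mul1r// expr1 mulN1r !ltrN2 andbC.
Qed.

Definition side_cutoff k x : R := \prod_(i < m)
  (expbump k (x ord0 (lift j i) - L (lift j i)) *
   expbump k (H (lift j i) - x ord0 (lift j i))).

(** The leading [s] cancels the one produced by the chain rule, so the [j]-th derivative is
    [dcutoff] times the side cutoffs for either sign. *)
Definition box_test k x : R :=
  s * (cutoff k a d (s * x ord0 j) * side_cutoff k x).

Lemma side_cutoff_ge0 k x : 0 <= side_cutoff k x.
Proof. by apply: prodr_ge0 => i _; rewrite mulr_ge0 ?expbump_ge0. Qed.

Lemma side_cutoff_le1 k x : side_cutoff k x <= 1.
Proof.
apply: prodr_ile1 => i _; rewrite mulr_ge0 ?expbump_ge0//=.
by rewrite -[leRHS]mul1r ler_pM ?expbump_ge0 ?expbump_le1.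
Qed.

Lemma side_cutoff_eq0 k x : 0 < k ->
  ~ (forall i, L (lift j i) < x ord0 (lift j i) < H (lift j i)) ->
  side_cutoff k x = 0.
Proof.
move=> k0 /existsNP[i /negP]; rewrite negb_and -!leNgt => Hi.
rewrite /side_cutoff (bigD1 i)//=; case/orP: Hi => Hi.
  by rewrite expbump_le0 ?subr_le0// !mul0r.
by rewrite [expbump k (H _ - _)]expbump_le0 ?subr_le0// mulr0 mul0r.
Qed.

Lemma cvg_side_cutoff x :
  (forall i, L (lift j i) < x ord0 (lift j i) < H (lift j i)) ->
  (side_cutoff k.+1%:R x : R) @[k --> \oo] --> (1 : R).
Proof.
move=> xLH; rewrite /side_cutoff.
have E : \prod_(i < m) ((1 : R) * 1) = 1 by rewrite mulr1 big1.
rewrite -[X in _ --> X]E.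
apply: cvg_big => [|i _]; first exact: mul_continuous.
have /andP[xL xH] := xLH i.
by apply: cvgM; apply: cvg_expbump; rewrite subr_gt0.
Qed.

Lemma polysmooth_side_cutoff k : polysmooth (side_cutoff k).
Proof.
apply: polysmooth_prod => i; apply: polysmoothM.
- apply: (@polysmooth_expbump _ _ _ 1 (- L (lift j i)) (lift j i)) => x.
  by rewrite mul1r.
- apply: (@polysmooth_expbump _ _ _ (-1) (H (lift j i)) (lift j i)) => x.
  by rewrite mulN1r addrC.
Qed.

Lemma polysmooth_box_test k : polysmooth (box_test k).
Proof.
apply: (@polysmoothM _ _ (cst s)); first exact: polysmooth_cst.
apply: polysmoothM; last exact: polysmooth_side_cutoff.
apply: polysmoothM.
  exact: (@polysmooth_expbump _ _ _ s (- a) j).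
apply: polysmoothM.
  rewrite (_ : (fun _ => _) = fun x => id (- s * x ord0 j + d)).
    exact: (polysmooth_coord j (- s) d csmooth_id).
  by apply/funext => x; rewrite mulNr addrC.
by apply: (@polysmooth_expbump _ _ _ (- s) d j) => x; rewrite mulNr addrC.
Qed.

Lemma is_derive_side_cutoff k x :
  is_derive x (delta_mx ord0 j) (side_cutoff k) 0.
Proof.
have E t : side_cutoff k (t *: delta_mx ord0 j + x) = side_cutoff k x.
  apply: eq_bigr => i _; rewrite !mxE eqxx/= (_ : lift j i == j = false).
    by rewrite mulr0 add0r.
  by apply/negbTE; rewrite eq_sym neq_lift.
have lim0 : (fun t : R => t^-1 *: (side_cutoff k (t *: delta_mx ord0 j + x) -
    side_cutoff k x) : R) @ 0^' --> (0 : R).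
  rewrite (_ : (fun _ => _) = cst 0); first exact: cvg_cst.
  by apply/funext => t; rewrite E subrr scaler0.
split; first by apply/cvg_ex; exists 0; exact: lim0.
exact/cvg_lim.
Qed.

Lemma is_derive_box_test k x : is_derive x (delta_mx ord0 j) (box_test k)
  (dcutoff k a d (s * x ord0 j) * side_cutoff k x).
Proof.
have dc := is_derive_cutoff k a d (s * x ord0 j + 0).
have {}dc := @is_derive_coord R _ (cutoff k a d) j j s 0 _ x dc.
have E : (fun x : 'rV[R]_m.+1 => cutoff k a d (s * x ord0 j + 0)) =
    (fun x => cutoff k a d (s * x ord0 j)).
  by apply/funext => y; rewrite addr0.
rewrite E addr0 in dc.
have ss : s * s = 1 by rewrite -signr_addb addbb expr0.
apply: (is_derive_eq (is_deriveZ s (is_deriveM dc (is_derive_side_cutoff k x)))).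
by rewrite /GRing.scale/= mulr0 add0r eqxx mulr1 (mulrCA s) (mulrA s s) ss mul1r mulrC.
Qed.

Lemma pderiv_box_test k x : pderiv j (box_test k) x =
  dcutoff k a d (s * x ord0 j) * side_cutoff k x.
Proof. by have [_ <-] := is_derive_box_test k x. Qed.

Lemma box_test_eq0 k x : 0 < k -> ~ obox L H x -> box_test k x = 0.
Proof.
move=> k0 /oboxE/not_andP[/negP xj|xi].
  by rewrite /box_test cutoff_eq0// mul0r mulr0.
by rewrite /box_test side_cutoff_eq0// !mulr0.
Qed.

Lemma pderiv_box_test_eq0 k x : 0 < k -> ~ obox L H x ->
  pderiv j (box_test k) x = 0.
Proof.
move=> k0 /oboxE/not_andP[/negP xj|xi]; rewrite pderiv_box_test.
  by rewrite dcutoff_eq0// mul0r.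
by rewrite side_cutoff_eq0// mulr0.
Qed.

(** The bumps vanish off the open box, so the support lies in the closed one, which is compact. *)
Lemma test_function_box_test Omega k : 0 < k -> cbox L H `<=` Omega ->
  test_function Omega (box_test k).
Proof.
move=> k0 cO.
have cl : closure [set x | box_test k x != 0] `<=` cbox L H.
  have -> : cbox L H = closure (cbox L H).
    apply: (closure_id _).1; apply: compact_closed; last exact: compact_cbox.
    exact: norm_hausdorff.
  apply: closure_subset => x /= Hx; apply: obox_cbox; apply: contrapT => nx.
  by move: Hx; rewrite box_test_eq0// eqxx.
split; first exact/polysmooth_smooth/polysmooth_box_test.
  by apply: subclosed_compact cl; [exact: closed_closure|exact: compact_cbox].
exact: subset_trans cl cO.
Qed.

End box_test_function.

(** * Dominated convergence and integrability for real integrands *)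

Section real_integral.
Context d (T : measurableType d) {R : realType} (mu : {measure set T -> \bar R}).
Implicit Types (D E : set T) (f g h : T -> R).

Lemma Rintegral_support D E f : D `<=` E -> (forall x, ~ D x -> f x = 0) ->
  \int[mu]_(x in E) f x = \int[mu]_(x in D) f x.
Proof.
move=> DE f0; rewrite Rintegral_mkcond [RHS]Rintegral_mkcond.
congr Rintegral; apply/funext => x; rewrite !patchE.
have [Dx|nDx] := pselect (D x); first by rewrite !mem_set//; exact: DE.
by rewrite f0//; case: ifP; case: ifP.
Qed.

Lemma Rdominated_convergence D (F : nat -> T -> R) f h : measurable D ->
  (forall n, measurable_fun D (F n)) -> measurable_fun D f ->
  (\forall x \ae mu, D x -> F n x @[n --> \oo] --> f x) ->
  mu.-integrable D (EFin \o h) ->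
  (\forall x \ae mu, D x -> forall n, `|F n x| <= h x) ->
  \int[mu]_(x in D) F n x @[n --> \oo] --> \int[mu]_(x in D) f x.
Proof.
move=> mD mF mf Ff hi Fh.
have [||||fi _ FI] := @dominated_convergence d T R mu D mD
  (fun n => EFin \o F n) (EFin \o f) (EFin \o h) _ _ _ hi _.
- by move=> n; exact/measurable_EFinP.
- exact/measurable_EFinP.
- move: Ff; apply: ae_mono => x Ff Dx.
  by apply: cvg_EFin; [exact: nearW|exact: Ff].
- by move: Fh; apply: ae_mono => x Fh n Dx; rewrite /= lee_fin; exact: Fh.
apply: fine_cvg; move: FI; rewrite fineK//.
exact: integrable_fin_num.
Qed.

Lemma integrable_bounded_mul D f g (C : R) : measurable D ->
  measurable_fun D f -> (forall x, D x -> `|f x| <= C) ->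
  mu.-integrable D (EFin \o g) -> mu.-integrable D (EFin \o (fun x => f x * g x)).
Proof.
move=> mD mf fC gi.
have /measurable_EFinP mg := measurable_int _ gi.
apply: (le_integrable mD (f := EFin \o (fun x => f x * g x))
    (g := fun x => (C%:E * (EFin \o g) x)%E)); last exact: integrableZl.
  by apply/measurable_EFinP; exact: measurable_funM.
move=> x Dx /=; rewrite lee_fin !normrM ler_wpM2r//.
exact: le_trans (fC x Dx) (ler_norm _).
Qed.

Lemma integrable_subr D f g : measurable D ->
  mu.-integrable D (EFin \o f) -> mu.-integrable D (EFin \o g) ->
  mu.-integrable D (EFin \o (fun x => f x - g x)).
Proof. by move=> mD fi gi; exact: (integrableB mD fi gi). Qed.

Lemma integrable_mulr D (c : R) f : measurable D ->
  mu.-integrable D (EFin \o f) -> mu.-integrable D (EFin \o (fun x => c * f x)).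
Proof. by move=> mD fi; exact: (integrableZl mD c fi). Qed.

End real_integral.

(** * The weak derivative tested on a box *)

Section weak_derivative_on_boxes.
Context {R : realType} {m : nat} (j : 'I_m.+1) (b : bool) (L H : 'I_m.+1 -> R).
Local Notation s := ((-1) ^+ b : R).
Local Notation mu := (@lebesgue_rV R m.+1).
Local Notation a := (box_start j b L H).
Local Notation d := (box_end j b L H).
Implicit Types (Omega : set 'rV[R]_m.+1) (f g : 'rV[R]_m.+1 -> R).

(* Letting the test functions tend to [(d - s x_j) 1_box] turns the weak
   derivative into this identity; where their derivatives blow up, near
   [s x_j = a], the function [f] vanishes. *)
Lemma weak_pderiv_box Omega f g (a1 : R) : open Omega ->
  weak_pderiv Omega j f g -> cbox L H `<=` Omega -> a < a1 ->
  (\forall x \ae mu, obox L H x -> s * x ord0 j < a1 -> f x = 0) ->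
  \int[mu]_(x in obox L H) f x =
  \int[mu]_(x in obox L H) ((d - s * x ord0 j) * (s * g x)).
Proof.
move=> oO [Lf Lg wfg] cO aa1 f0; set D := obox L H.
have mD : measurable D by exact: measurable_obox.
have DO : D `<=` Omega by exact: subset_trans (@obox_cbox _ _ L H) cO.
have inD h : Lploc 1 Omega h -> mu.-integrable D (EFin \o h).
  have cc : compact (cbox L H) by exact: compact_cbox.
  move=> Lh; apply: (integrableS (compact_measurable_rV cc) mD).
    exact: obox_cbox.
  exact: Lploc1_integrable Lh oO cc cO.
have fi := inD f Lf; have gi := inD g Lg.
have /measurable_EFinP mf := measurable_int _ fi.
have /measurable_EFinP mg := measurable_int _ gi.
pose phi n := box_test j b L H n.+1%:R.
have sphi n : polysmooth (phi n) by exact: polysmooth_box_test.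
have mphi n : measurable_fun D (phi n).
  apply: measurable_funTS.
  by apply: continuous_measurable_rV; exact: polysmooth_continuous (sphi n).
have mdphi n : measurable_fun D (pderiv j (phi n)).
  apply: measurable_funTS; apply: continuous_measurable_rV.
  by have [] := polysmooth_smooth (sphi n) [:: j].
have mdist : measurable_fun D (fun x => d - s * x ord0 j).
  apply: measurable_funTS; apply: measurable_funB => //.
  by apply: measurable_funM => //; exact: measurable_coord_rV.
have n0 n : 0 < n.+1%:R :> R by rewrite ltr0n.
have n1 n : 1 <= n.+1%:R :> R by rewrite ler1n.
have s1 : `|s| = 1 by rewrite normr_sign.
(* The test function and its derivative vanish off the box, so both integrals over [Omega] reduce to
   integrals over [D]. *)
have key n : \int[mu]_(x in D) (f x * pderiv j (phi n) x) =
    - \int[mu]_(x in D) (g x * phi n x).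
  have := wfg (phi n) (test_function_box_test j b (n0 n) cO).
  rewrite (@Rintegral_support _ _ _ mu D Omega); [|exact: DO|]; last first.
    by move=> x nDx; rewrite (pderiv_box_test_eq0 _ _ (n0 n) nDx) mulr0.
  rewrite (@Rintegral_support _ _ _ mu D Omega); [|exact: DO|]; last first.
    by move=> x nDx; rewrite /phi (box_test_eq0 _ _ (n0 n) nDx) mulr0.
  by [].
have cvf : \int[mu]_(x in D) (f x * pderiv j (phi n) x) @[n --> \oo] -->
    \int[mu]_(x in D) (- f x).
  apply: (@Rdominated_convergence _ _ _ mu D _ _
    (fun x => (2 + (d - a) / (a1 - a) ^+ 2) * `|f x|)) => //.
  - by move=> n; exact: measurable_funM.
  - exact: measurable_funN.
  - move: f0; apply: ae_mono => x f0 Dx.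
    have /(oboxE j b)[xj xi] := Dx.
    have [xa1|xa1] := ltP (s * x ord0 j) a1.
      rewrite f0// oppr0 (_ : (fun _ => _) = cst 0); first exact: cvg_cst.
      by apply/funext => n; rewrite mul0r.
    rewrite (_ : (fun _ => _) = (fun n : nat => f x *
        (dcutoff n.+1%:R a d (s * x ord0 j) * side_cutoff j L H n.+1%:R x))).
      have c1 := @cvg_dcutoff R _ _ _ xj; have c2 := cvg_side_cutoff xi.
      have cf : (fun _ : nat => f x) @ \oo --> f x by exact: cvg_cst.
      by have := cvgM cf (cvgM c1 c2); rewrite mulr1 mulrN1; exact.
    by apply/funext => n; rewrite /phi pderiv_box_test.
  - rewrite (_ : EFin \o _ = fun x => ((2 + (d - a) / (a1 - a) ^+ 2)%:E *
       (EFin \o (fun x => `|f x|)%R) x)%E)//.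
    by apply: integrableZl => //; exact: integrable_norm.
  - move: f0; apply: ae_mono => x f0 Dx n.
    have /(oboxE j b)[xj xi] := Dx.
    have [xa1|xa1] := ltP (s * x ord0 j) a1.
      by rewrite f0// mul0r normr0 mulr0.
    rewrite normrM mulrC ler_wpM2r// pderiv_box_test normrM -[leRHS]mulr1.
    rewrite ler_pM// ?(ger0_norm (side_cutoff_ge0 _ _ _ _ _)) ?side_cutoff_le1//.
    apply: dcutoff_bound => //; rewrite xa1.
    by case/andP: xj.
(* Unlike their derivatives, the test functions are bounded by [d - a] on the whole box, uniformly
   in [n]. *)
have cvgg : \int[mu]_(x in D) (g x * phi n x) @[n --> \oo] -->
    \int[mu]_(x in D) ((d - s * x ord0 j) * (s * g x)).
  apply: (@Rdominated_convergence _ _ _ mu D _ _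
    (fun x => (d - a) * `|g x|)) => //.
  - by move=> n; exact: measurable_funM.
  - by apply: measurable_funM => //; exact: measurable_funM.
  - apply: aeW => x Dx; have /(oboxE j b)[xj xi] := Dx.
    have c1 := @cvg_cutoff R _ _ _ xj; have c2 := cvg_side_cutoff xi.
    have cg : (fun _ : nat => g x) @ \oo --> g x by exact: cvg_cst.
    have cs : (fun _ : nat => s) @ \oo --> s by exact: cvg_cst.
    have := cvgM cg (cvgM cs (cvgM c1 c2)).
    have -> : g x * (s * ((d - s * x ord0 j) * 1)) =
        (d - s * x ord0 j) * (s * g x).
      by rewrite mulr1; move: (d - _) => w; rewrite mulrA mulrC (mulrC (g x)).
    exact.
  - rewrite (_ : EFin \o _ = fun x => ((d - a)%:E *
       (EFin \o (fun x => `|g x|)%R) x)%E)//.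
    by apply: integrableZl => //; exact: integrable_norm.
  - apply: aeW => x Dx n; have /(oboxE j b)[xj xi] := Dx.
    rewrite normrM mulrC ler_wpM2r// /phi /box_test normrM s1 mul1r normrM -[leRHS]mulr1.
    rewrite ler_pM// ?(ger0_norm (side_cutoff_ge0 _ _ _ _ _)) ?side_cutoff_le1//.
    exact: cutoff_bound.
have E : \int[mu]_(x in D) (- f x) =
    - \int[mu]_(x in D) ((d - s * x ord0 j) * (s * g x)).
  apply: (cvg_unique (@Rhausdorff R) cvf).
  rewrite (_ : (fun n => _) = (fun n => - \int[mu]_(x in D) (g x * phi n x))).
    exact: cvgN cvgg.
  exact/funext.
apply: oppr_inj; rewrite -E -[LHS]mulN1r -RintegralZl//.
by apply: eq_Rintegral => x _; rewrite mulN1r.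
Qed.

End weak_derivative_on_boxes.

(** * Functions with zero integral over every box *)

Section density.
Context d (T : measurableType d) {R : realType} (mu : {measure set T -> \bar R}).
Variable f : T -> \bar R.
Hypotheses (mf : measurable_fun setT f) (f0 : forall x, (0 <= f x)%E).
Local Open Scope ereal_scope.

(** Turns the positive and negative parts of a function into measures, to which
    [obox_measure_unique] applies. *)
Lemma density_measure_ex :
  {m : {measure set T -> \bar R} | forall A, m A = \int[mu]_(x in A) f x}.
Proof.
pose m A := \int[mu]_(x in A) f x.
have m0 : m set0 = 0 by exact: integral_set0.
have m_ge0 A : 0 <= m A by exact: integral_ge0.
have msa : semi_sigma_additive m by exact: semi_sigma_additive_nng_induced.
pose mm := isMeasure.Build d T R m m0 m_ge0 msa.
pose m' : {measure set T -> \bar R} := HB.pack m mm.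
by exists m'.
Qed.

End density.

Section ae_zero.
Context {R : realType}.
Local Open Scope ereal_scope.

(** The finite measures with densities the positive and negative parts of [h] agree on boxes, hence
    on all Borel sets, so [h] has zero integral over each of these. *)
Lemma obox_integral_ae_eq0 n (h : 'rV[R]_n -> \bar R) :
  lebesgue_rV.-integrable setT h ->
  (forall lo hi, \int[lebesgue_rV]_(x in obox lo hi) h x = 0) ->
  \forall x \ae lebesgue_rV, h x = 0.
Proof.
move=> hi h0; have mh := measurable_int _ hi.
have [mp mpE] := density_measure_ex lebesgue_rV (measurable_funepos mh) (funepos_ge0 h).
have [mn mnE] := density_measure_ex lebesgue_rV (measurable_funeneg mh) (funeneg_ge0 h).
have hiA A : measurable A -> lebesgue_rV.-integrable A h.
  by move=> mA; apply: integrableS hi.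
have mpoo A : measurable A -> mp A \is a fin_num.
  move=> mA; rewrite mpE; apply: integrable_fin_num => //.
  by apply: integrable_funepos => //; exact: hiA.
have mnoo A : measurable A -> mn A \is a fin_num.
  move=> mA; rewrite mnE; apply: integrable_fin_num => //.
  by apply: integrable_funeneg => //; exact: hiA.
have hE A : measurable A -> \int[lebesgue_rV]_(x in A) h x = mp A - mn A.
  by move=> mA; rewrite integralE mpE mnE.
have mpn A : measurable A -> mp A = mn A.
  apply: obox_measure_unique => lo hi'.
    have mA := measurable_obox lo hi'.
    have := hE _ mA; rewrite h0 -(fineK (mpoo _ mA)) -(fineK (mnoo _ mA)).
    by rewrite -EFinB => -[/esym/subr0_eq ->].
  by rewrite ltey_eq mpoo//; exact: measurable_obox.
have := @integral_ae_eq _ _ _ lebesgue_rV setT measurableT (cst 0) h hi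
  (measurable_cst _).
move=> H; have {H} : ae_eq lebesgue_rV setT h (cst 0).
  apply: H => E _ mE; rewrite integral0 hE// mpn// subee//.
  exact: mnoo.
by apply: ae_mono => x; exact.
Qed.

(** * Null sets and integrals on slices of a product *)

Context d1 d2 (T1 : measurableType d1) (T2 : measurableType d2).
Variables (m1 : {sigma_finite_measure set T1 -> \bar R})
  (m2 : {sigma_finite_measure set T2 -> \bar R}).

Lemma ae_slice (P : T1 * T2 -> Prop) : (\forall p \ae (m1 \x m2), P p) ->
  \forall y \ae m2, \forall x \ae m1, P (x, y).
Proof.
move=> [N [mN N0 PN]].
have mI : measurable_fun setT (EFin \o (\1_N : T1 * T2 -> R)).
  by apply/measurable_EFinP; exact: measurable_indic.
have I0 p : 0 <= (EFin \o (\1_N : T1 * T2 -> R)) p by rewrite lee_fin.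
have := @fubini_tonelli2 _ _ _ _ _ m1 m2 _ mI I0.
rewrite integral_indic// setIT => E.
have {}E : \int[m2]_y fubini_G m1 (EFin \o (\1_N : T1 * T2 -> R)) y = 0.
  by rewrite -E; exact: N0.
have mG := @measurable_fun_fubini_tonelli_G _ _ _ _ _ m1 _ mI I0.
have : ae_eq m2 setT (fubini_G m1 (EFin \o (\1_N : T1 * T2 -> R))) (cst 0).
  apply/ae_eq_integral_abs => //; rewrite -[RHS]E.
  by apply: eq_integral => y _; rewrite gee0_abs// integral_ge0.
apply: ae_mono => y /(_ I) Ey.
have mNy : measurable (fun x => N (x, y)).
  by rewrite -[X in measurable X]setTI; exact: measurable_pair2.
exists (fun x => N (x, y)); split => //; last by move=> x /= nP; apply: PN.
rewrite -[RHS]Ey /fubini_G.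
by have := integral_indic m1 measurableT mNy; rewrite setIT => <-.
Qed.

(** A converse to [ae_slice]. Since null slices force a set to be null only if it is measurable, it
    is phrased for an integrable function, through its L^1 norm. *)
Lemma ae_of_slices (f : T1 * T2 -> R) : (m1 \x m2).-integrable setT (EFin \o f) ->
  (\forall y \ae m2, \forall x \ae m1, f (x, y) = 0%R) ->
  \int[m1 \x m2]_p `|f p|%:E = 0.
Proof.
move=> fi f0.
have mf : measurable_fun setT (fun p => `|f p|%:E).
  apply/measurable_EFinP; apply: measurableT_comp => //.
  by apply/measurable_EFinP; exact: measurable_int fi.
have nf0 p : 0 <= `|f p|%:E by rewrite lee_fin.
rewrite (@fubini_tonelli2 _ _ _ _ _ m1 m2 _ mf nf0).
have mG := @measurable_fun_fubini_tonelli_G _ _ _ _ _ m1 _ mf nf0.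
rewrite (ae_eq_integral (cst 0))// ?integral0//.
move: f0; apply: ae_mono => y f0 _; rewrite /fubini_G /=.
rewrite (ae_eq_integral (cst 0))// ?integral0//.
  exact: (measurableT_comp mf (measurable_pair2 y)).
by move: f0; apply: ae_mono => x -> _; rewrite normr0.
Qed.

Lemma integrable_fubini_G (f : T1 * T2 -> \bar R) :
  (m1 \x m2).-integrable setT f -> m2.-integrable setT (fubini_G m1 f).
Proof.
move=> fi; have mf := measurable_int _ fi.
have mnf : measurable_fun setT (abse \o f) by exact: measurableT_comp.
apply/integrableP; split; first exact: measurable_fubini_G fi.
apply: le_lt_trans ((integrable21ltyP m1 m2 mf).1 fi).
apply: ge0_le_integral => //.
- by apply: measurableT_comp => //; exact: measurable_fubini_G fi.
- exact: (@measurable_fun_fubini_tonelli_G _ _ _ _ _ m1 _ mnf (fun=> abse_ge0 _)).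
- move=> y _; apply: le_abse_integral => //.
  exact: (measurableT_comp mf (measurable_pair2 y)).
Qed.

Lemma integral_fubini_G_setX (f : T1 * T2 -> \bar R) (B : set T2) : measurable B ->
  (m1 \x m2).-integrable setT f ->
  \int[m2]_(y in B) fubini_G m1 f y = \int[m1 \x m2]_(p in setT `*` B) f p.
Proof.
move=> mB fi; have mTB : measurable (setT `*` B : set (T1 * T2)) by exact: measurableX.
have fBi : (m1 \x m2).-integrable setT (f \_ (setT `*` B)).
  by apply/(integrable_mkcond _ mTB); exact: integrableS fi.
rewrite [RHS]integral_mkcond -(integral21_prod_meas1 fBi) integral_mkcond.
apply: eq_integral => y _; rewrite /fubini_G !patchE; case: ifPn => By.
  apply: eq_integral => x _; rewrite patchE ifT//.
  by rewrite inE; split => //=; exact: set_mem.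
rewrite -[LHS](integral0 m1 setT); apply: eq_integral => x _.
rewrite patchE memNset// => -[_ /= yB].
by move/negP: By; apply; exact: mem_set.
Qed.

End ae_zero.

(** * Comparison with the Euclidean norm *)

Section euclidean_norm.
Context {R : realType}.

Lemma coord_le_enorm m n (A : 'M[R]_(m, n)) i j : `|A i j| <= enorm A.
Proof.
rewrite -[leLHS]ger0_norm// -sqrtr_sqr ler_wsqrtr//.
rewrite (bigD1 i)//= (bigD1 j)//= -addrA lerDl addr_ge0//.
  by apply: sumr_ge0 => l _; exact: sqr_ge0.
by apply: sumr_ge0 => l _; apply: sumr_ge0 => l' _; exact: sqr_ge0.
Qed.

(** The square of the sum contains every [|x_i|^2] among nonnegative products. The sum is the form
    in which [gronwall_system] bounds derivatives. *)
Lemma enorm_row_le_sum n (x : 'rV[R]_n) : enorm x <= \sum_i `|x ord0 i|.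
Proof.
have S0 : 0 <= \sum_i `|x ord0 i| by exact: sumr_ge0.
rewrite -(ger0_norm S0) -sqrtr_sqr ler_wsqrtr// big_ord_recl big_ord0 addr0.
rewrite expr2 mulr_suml ler_sum// => i _.
by rewrite expr2 ler_wpM2l// (bigD1 i)//= lerDl sumr_ge0.
Qed.

End euclidean_norm.

(** * Slabs in a signed direction and functions on them *)

Section slabs.
Context {R : realType} {m : nat} (j : 'I_m.+1) (b : bool).
Local Notation s := ((-1) ^+ b : R).
Local Notation e := (@rV_insert R m j b).
Implicit Types (a q : R) (lo hi : 'I_m -> R).

(* [slab a q lo hi] is the open box given in the coordinates of [rV_insert]:
   [a < (-1)^b x_j < q], and [lo], [hi] bound the other coordinates. *)
Definition slab_lo a q lo (i : 'I_m.+1) : R :=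
  if unlift j i is Some k then lo k else if b then - q else a.
Definition slab_hi a q hi (i : 'I_m.+1) : R :=
  if unlift j i is Some k then hi k else if b then - a else q.
Definition slab a q lo hi := obox (slab_lo a q lo) (slab_hi a q hi).

Lemma slab_start a q lo hi : box_start j b (slab_lo a q lo) (slab_hi a q hi) = a.
Proof.
by rewrite /box_start /slab_lo /slab_hi unlift_none; case: b; rewrite ?opprK.
Qed.

Lemma slab_end a q lo hi : box_end j b (slab_lo a q lo) (slab_hi a q hi) = q.
Proof.
by rewrite /box_end /slab_lo /slab_hi unlift_none; case: b; rewrite ?opprK.
Qed.

Lemma preimage_slab a q lo hi : e @^-1` slab a q lo hi = `]a, q[%classic `*` obox lo hi.
Proof.
rewrite /slab rV_insert_preimage_obox /slab_lo /slab_hi unlift_none.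
congr (_ `*` _); first by case: b; rewrite ?opprK.
by apply/seteqP; split=> x Hx i; have := Hx i; rewrite liftK.
Qed.

Lemma sign_rV_insertE p : s * e p ord0 j = p.1.
Proof. by rewrite rV_insertE mulrA -signr_addb addbb expr0 mul1r. Qed.

End slabs.

Section functions_on_slabs.
Context {R : realType} {m : nat} (j : 'I_m.+1) (b : bool) (a d : R) (lo hi : 'I_m -> R).
Local Notation s := ((-1) ^+ b : R).
Local Notation e := (@rV_insert R m j b).
Local Notation leb := (@lebesgue_measure R).
Local Notation mu := (@lebesgue_rV R m.+1).
Local Notation nu := (leb \x @lebesgue_rV R m)%E.
Local Notation D := (slab j b a d lo hi).
Local Notation cslab := (cbox (slab_lo j b a d lo) (slab_hi j b a d hi)).
Local Notation P := (`]a, d[%classic `*` obox lo hi).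
Implicit Types (h f g : 'rV[R]_m.+1 -> R) (Omega : set 'rV[R]_m.+1).

(** Extension by zero makes every slice a function on the whole line, as the Gronwall lemmas ask for
    integrability over [setT]. *)
Definition on_slab h (p : measurableTypeR R * 'rV[R]_m) : R := ((h \o e) \_ P) p.

Lemma measurable_slab : measurable D.
Proof. exact: measurable_obox. Qed.

Lemma on_slabE h p : P p -> on_slab h p = h (e p).
Proof. by move=> Pp; rewrite /on_slab patchE mem_set. Qed.

Lemma on_slab_eq0 h p : ~ P p -> on_slab h p = 0.
Proof. by move=> Pp; rewrite /on_slab patchE memNset. Qed.

Lemma integrable_on_slab h : mu.-integrable D (EFin \o h) ->
  nu.-integrable setT (EFin \o on_slab h).
Proof.
move=> hi'; have := integrable_rV_insert j b measurable_slab hi'.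
have mP : measurable (e @^-1` D).
  by rewrite -[X in measurable X]setTI; exact: measurable_rV_insert measurable_slab.
move=> /(integrable_mkcond _ mP).
by rewrite preimage_slab (restrict_EFin (h \o e)).
Qed.

Lemma integral_on_slab h : mu.-integrable D (EFin \o h) ->
  (\int[mu]_(x in D) `|h x|%:E = \int[nu]_p `|on_slab h p|%:E)%E.
Proof.
move=> hi'; have hn := integrable_norm hi'.
rewrite (integral_rV_insert j b measurable_slab hn) preimage_slab integral_mkcond.
apply: eq_integral => p _; rewrite patchE; case: ifPn => Pp.
  by rewrite on_slabE// -in_setE.
by rewrite on_slab_eq0 ?normr0// => /mem_set; exact/negP.
Qed.

Lemma integrable_slab_coord g : mu.-integrable D (EFin \o g) ->
  mu.-integrable D (EFin \o (fun x : 'rV[R]_m.+1 => s * x ord0 j * g x)).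
Proof.
apply: (@integrable_bounded_mul _ _ _ mu D (fun x : 'rV[R]_m.+1 => s * x ord0 j) g
  (`|a| + `|d|)); first exact: measurable_slab.
- apply: measurable_funTS; apply: measurable_funM => //.
  exact: measurable_coord_rV.
- move=> x /(oboxE j b)[+ _]; rewrite slab_start slab_end => /andP[ax xd].
  rewrite ler_norml; apply/andP; split.
    rewrite lerNl (@le_trans _ _ (- a))//; first by rewrite lerN2 ltW.
    by rewrite (le_trans (ler_norm _))// normrN lerDl.
  by rewrite (le_trans (ltW xd))// (le_trans (ler_norm d))// lerDr.
Qed.

End functions_on_slabs.

(** * The integral identity on almost every line *)

Section slices.
Context {R : realType} {m : nat} (j : 'I_m.+1) (b : bool) (a d : R) (lo hi : 'I_m -> R).
Local Notation s := ((-1) ^+ b : R).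
Local Notation e := (@rV_insert R m j b).
Local Notation leb := (@lebesgue_measure R).
Local Notation mu := (@lebesgue_rV R m.+1).
Local Notation nu := (leb \x @lebesgue_rV R m)%E.
Local Notation D := (slab j b a d lo hi).
Local Notation cslab := (cbox (slab_lo j b a d lo) (slab_hi j b a d hi)).
Implicit Types (h f g : 'rV[R]_m.+1 -> R) (Omega : set 'rV[R]_m.+1).

Lemma Lploc1_integrable_slab Omega f : Lploc 1 Omega f -> open Omega ->
  cslab `<=` Omega -> mu.-integrable D (EFin \o f).
Proof.
move=> Lf oO cO; have cc : compact cslab by exact: compact_cbox.
apply: (integrableS (compact_measurable_rV cc)).
- exact: measurable_slab.
- exact: obox_cbox.
- exact: Lploc1_integrable Lf oO cc cO.
Qed.

Lemma Lploc2_integrable_slab Omega f : Lploc 2 Omega f -> open Omega ->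
  cslab `<=` Omega -> mu.-integrable D (EFin \o f).
Proof.
move=> [mf f2] oO cO; have cc : compact cslab by exact: compact_cbox.
have mD : measurable D by exact: measurable_slab.
have mc := compact_measurable_rV cc.
have mfD : measurable_fun D f.
  apply: measurable_funS mf; first exact: open_measurable_rV.
  exact: subset_trans (@obox_cbox _ _ _ _) cO.
have f2i : mu.-integrable D (EFin \o (fun x => `|f x| ^+ 2)).
  apply/integrableP; split.
    by apply/measurable_EFinP; apply: measurable_funX; exact: measurableT_comp.
  apply: le_lt_trans (f2 _ cc cO).
  have mfc : measurable_fun cslab (fun x => `|f x| ^+ 2).
    apply: measurable_funX; apply: measurableT_comp => //.
    by apply: measurable_funS mf => //; exact: open_measurable_rV.
  rewrite (eq_integral (fun x => (`|f x| ^+ 2)%:E)); last first.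
    by move=> x _ /=; rewrite ger0_norm ?sqr_ge0.
  apply: ge0_subset_integral => //.
  - exact/measurable_EFinP.
  - exact: obox_cbox.
have i1 : mu.-integrable D (EFin \o (cst (1 : R))).
  apply/integrableP; split; first exact: (@measurable_cst _ _ _ _ D 1%:E).
  rewrite (eq_integral (fun=> 1%:E)); last by move=> x _ /=; rewrite normr1.
  rewrite integral_cst// mul1e; exact: lebesgue_rV_obox_lty.
(* Square integrability gives integrability through [|f| <= |f|^2 + 1], the slab having finite
   measure. *)
apply: (le_integrable mD (f := EFin \o f)
  (g := fun x => ((EFin \o (fun x => `|f x| ^+ 2)%R) x + (EFin \o cst 1%R) x)%E)).
- exact/measurable_EFinP.
- move=> x _; rewrite -EFinD /= lee_fin [leRHS]ger0_norm ?addr_ge0 ?sqr_ge0//.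
  have := sqr_ge0 (`|f x| - 1); have := sqr_ge0 (`|f x|); nra.
- exact: integrableD.
Qed.

(** Applied to sub-slabs ending at [q] with varying sides, [weak_pderiv_box] says that the line
    integral of [f - (q - s x_j) s g], as a function of [y], has zero integral over every box.
    Integrability of the slices is a premise inside the almost everywhere statement: it serves to
    split the line integral, and it holds off a null set independent of [q]. *)
Lemma slice_identity Omega f g (a1 q : R) : open Omega ->
  weak_pderiv Omega j f g -> cslab `<=` Omega -> a < a1 ->
  (\forall x \ae mu, D x -> s * x ord0 j < a1 -> f x = 0) -> a < q < d ->
  let F := on_slab j b a d lo hi f in
  let G := on_slab j b a d lo hi (fun x => s * g x) in
  \forall y \ae lebesgue_rV,
    leb.-integrable setT (EFin \o (fun t => F (t, y))) ->
    leb.-integrable setT (EFin \o (fun t => G (t, y))) ->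
    leb.-integrable setT (EFin \o (fun t => t * G (t, y))) ->
    \int[leb]_(t in `[a, q]) F (t, y) = q * \int[leb]_(t in `[a, q]) G (t, y) -
      \int[leb]_(t in `[a, q]) (t * G (t, y)).
Proof.
move=> oO wfg cO aa1 f0 /andP[aq qd] F G.
have [Lf Lg _] := wfg.
have fi := Lploc1_integrable_slab Lf oO cO.
have gi := Lploc1_integrable_slab Lg oO cO.
have mD : measurable D by exact: measurable_slab.
have sub lo' hi' : (forall k, lo k <= lo' k) -> (forall k, hi' k <= hi k) ->
    slab j b a q lo' hi' `<=` D.
  move=> lo_le hi_le x /(oboxE j b)[+ xi]; rewrite slab_start slab_end => xj.
  apply/(oboxE j b); rewrite slab_start slab_end; split=> [|k].
    by case/andP: xj => -> /lt_trans -> //.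
  have := xi k; rewrite /slab_lo /slab_hi !liftK => /andP[? ?].
  by rewrite (le_lt_trans (lo_le k))//= (lt_le_trans _ (hi_le k)).
have csub lo' hi' : (forall k, lo k <= lo' k) -> (forall k, hi' k <= hi k) ->
    cbox (slab_lo j b a q lo') (slab_hi j b a q hi') `<=` cslab.
  move=> lo_le hi_le x xlh i; have := xlh i; rewrite /slab_lo /slab_hi.
  case: (unliftP j i) => [k _|_] /andP[lx xh].
    by rewrite (le_trans (lo_le k))//= (le_trans xh).
  case: b lx xh => lx xh; last by rewrite lx (le_trans xh)// ltW.
  by rewrite xh andbT (le_trans _ lx)// lerN2 ltW.
pose h x := f x - (q - s * x ord0 j) * (s * g x).
have hiD : mu.-integrable D (EFin \o h).
  have sgi : mu.-integrable D (EFin \o (fun x => s * g x)).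
    exact: integrable_mulr.
  have qgi : mu.-integrable D (EFin \o (fun x => q * (s * g x))).
    exact: integrable_mulr.
  have xgi := integrable_slab_coord sgi.
  rewrite (_ : h = fun x => f x - (q * (s * g x) - s * x ord0 j * (s * g x))).
    by apply: integrable_subr => //; exact: integrable_subr.
  by apply/funext => x; rewrite /h mulrBl.
pose E := on_slab j b a q lo hi h.
have Ei : nu.-integrable setT (EFin \o E).
  apply: integrable_on_slab; apply: (integrableS mD) hiD; first exact: measurable_slab.
  exact: sub.
have : \forall y \ae lebesgue_rV, fubini_G leb (EFin \o E) y = 0%E.
  apply: obox_integral_ae_eq0; first exact: integrable_fubini_G.
  move=> lo' hi'; rewrite integral_fubini_G_setX//; last exact: measurable_obox.
  (* A box in [y] is first cut down to the sides [lo], [hi], off which [E] vanishes. *)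
  pose lo'' k := Num.max (lo k) (lo' k); pose hi'' k := Num.min (hi k) (hi' k).
  have lo_le k : lo k <= lo'' k by rewrite le_max lexx.
  have hi_le k : hi'' k <= hi k by rewrite ge_min lexx.
  have sS : setT `*` obox lo' hi' `&` (`]a, q[%classic `*` obox lo hi) =
      e @^-1` slab j b a q lo'' hi''.
    rewrite preimage_slab; apply/seteqP; split=> -[t y] /=.
      move=> [[_ y1] [tq y2]]; split => // k; rewrite gt_max lt_min.
      by have /andP[-> ->] := y1 k; have /andP[-> ->] := y2 k.
    move=> [tq y3]; split; split => // k; have := y3 k; rewrite gt_max lt_min;
      by move=> /andP[/andP[? ?] /andP[? ?]]; exact/andP.
  have mS : measurable (slab j b a q lo'' hi'') by exact: measurable_slab.
  have EE : EFin \o E = ((EFin \o h) \o e) \_ (`]a, q[%classic `*` obox lo hi).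
    by apply/funext => p; rewrite /E /on_slab /= !patchE; case: ifP.
  rewrite EE -integral_mkcondr sS.
  have hiS : mu.-integrable (slab j b a q lo'' hi'') (EFin \o h).
    by apply: (integrableS mD mS) hiD; exact: sub.
  rewrite -(integral_rV_insert j b mS hiS).
  have := @weak_pderiv_box R m j b (slab_lo j b a q lo'') (slab_hi j b a q hi'')
    Omega f g a1 oO wfg.
  rewrite slab_start slab_end => /(_ (subset_trans (csub _ _ lo_le hi_le) cO) aa1).
  have f0S : \forall x \ae mu, slab j b a q lo'' hi'' x ->
      s * x ord0 j < a1 -> f x = 0.
    by apply: ae_mono f0 => x f0 Sx; apply: f0; exact: sub Sx.
  move=> /(_ f0S) wE.
  have fS : mu.-integrable (slab j b a q lo'' hi'') (EFin \o f).
    by apply: (integrableS mD mS) fi; exact: sub.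
  have gS : mu.-integrable (slab j b a q lo'' hi'')
      (EFin \o (fun x : 'rV[R]_m.+1 => (q - s * x ord0 j) * (s * g x))).
    rewrite (_ : (fun _ => _) = fun x => f x - h x).
      exact: integrable_subr.
    by apply/funext => x; rewrite /h opprB addrCA subrr addr0.
  have h_fin := integrable_fin_num mS hiS.
  rewrite -(fineK h_fin) -/(Rintegral mu (slab j b a q lo'' hi'') h).
  by rewrite /h RintegralB// wE subrr.
apply: ae_mono => y Hy Fi Gi tGi.
(* [E] lives over the open interval, and end points are null. *)
have aqE (v : R -> R) : leb.-integrable setT (EFin \o v) ->
    \int[leb]_(t in `[a, q]) v t = \int[leb]_(t in `]a, q[) v t.
  move=> fi'; rewrite Rintegral_itv_bndo_bndc; last exact: integrableT_sub fi'.
  by rewrite Rintegral_itv_obnd_cbnd//; exact: integrableT_sub fi'.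
rewrite !aqE//.
have mI : measurable (`]a, q[%classic : set R) by exact: measurable_itv.
rewrite -RintegralZl//; last exact: integrableT_sub Gi.
have qGi : leb.-integrable `]a, q[%classic (EFin \o (fun t => q * G (t, y))).
  by apply: integrable_mulr => //; exact: integrableT_sub Gi.
rewrite -RintegralB//; last exact: integrableT_sub tGi.
apply/eqP; rewrite -subr_eq0 -RintegralB//; last 2 first.
- exact: integrableT_sub Fi.
- by apply: integrable_subr => //; exact: integrableT_sub tGi.
apply/eqP; rewrite /Rintegral -[RHS]/(fine 0%E); congr fine.
rewrite -[RHS]Hy /fubini_G integral_mkcond; apply: eq_integral => t _.
rewrite patchE /E /=; case: ifPn => [|tq].
  rewrite in_setE /= => tq; have [yB|yB] := pselect (obox lo hi y).
    have tdP : (`]a, d[%classic `*` obox lo hi) (t, y).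
      split => //=; move: tq; rewrite !in_itv/= => /andP[-> /lt_trans]; exact.
    have tqP : (`]a, q[%classic `*` obox lo hi) (t, y) by [].
    rewrite (on_slabE j b h tqP) /F /G !(on_slabE j b _ tdP).
    by rewrite /h sign_rV_insertE -mulrBl.
  by rewrite /F /G !on_slab_eq0 ?mulr0 ?subrr//= => -[].
rewrite on_slab_eq0// => -[/= tq' _].
by move/negP: tq; apply; exact: mem_set.
Qed.

End slices.

(** * Propagation of zeros across a slab *)

Section half_sweep.
Context {R : realType} {m M : nat} (j : 'I_m.+1) (b : bool) (a d : R) (lo hi : 'I_m -> R).
Local Notation s := ((-1) ^+ b : R).
Local Notation e := (@rV_insert R m j b).
Local Notation leb := (@lebesgue_measure R).
Local Notation mu := (@lebesgue_rV R m.+1).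
Local Notation nu := (leb \x @lebesgue_rV R m)%E.
Local Notation D := (slab j b a d lo hi).
Local Notation cslab := (cbox (slab_lo j b a d lo) (slab_hi j b a d hi)).
Local Notation on := (on_slab j b a d lo hi).

Lemma slab_sweep (Omega : set 'rV[R]_m.+1) (V : 'rV[R]_m.+1 -> R)
    (u : 'rV[R]_m.+1 -> 'rV[R]_M) (Du : 'rV[R]_m.+1 -> 'M[R]_(m.+1, M)) (a1 : R) :
  open Omega -> Lploc 2 Omega V -> weak_gradient Omega u Du ->
  (\forall x \ae mu, Omega x -> enorm (Du x) <= V x * enorm (u x)) ->
  cslab `<=` Omega -> a < a1 ->
  (\forall x \ae mu, D x -> s * x ord0 j < a1 -> u x = 0) ->
  \forall x \ae mu, D x -> u x = 0.
Proof.
move=> oO LV wDu Duu cO aa1 u0.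
have mD : measurable D by exact: measurable_slab.
have DO : D `<=` Omega by exact: subset_trans (@obox_cbox _ _ _ _) cO.
pose f k (x : 'rV[R]_m.+1) := u x ord0 k.
pose g k (x : 'rV[R]_m.+1) := s * Du x j k.
have fi k : mu.-integrable D (EFin \o f k).
  by have [Lf _ _] := wDu j k; exact: Lploc1_integrable_slab Lf oO cO.
have gi k : mu.-integrable D (EFin \o g k).
  have [_ Lg _] := wDu j k; apply: integrable_mulr => //.
  exact: Lploc1_integrable_slab Lg oO cO.
have xgi k := integrable_slab_coord (gi k).
(* [V] carries no sign, hence its absolute value as coefficient. *)
have Vi := integrable_norm (Lploc2_integrable_slab LV oO cO).
have Fi := ae_forall_fin (fun k => ae_integrable2 (integrable_on_slab (fi k))).
have Gi := ae_forall_fin (fun k => ae_integrable2 (integrable_on_slab (gi k))).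
have tGi := ae_forall_fin (fun k => ae_integrable2 (integrable_on_slab (xgi k))).
have Wi := ae_integrable2 (integrable_on_slab Vi).
have f0 k : \forall x \ae mu, D x -> s * x ord0 j < a1 -> f k x = 0.
  by move: u0; apply: ae_mono => x u0 Dx xa1; rewrite /f u0// mxE.
(* One null set of [y] serves all components and all rational end points; this is why
   [gronwall_system] takes the identity at rationals. *)
have idn : \forall y \ae lebesgue_rV, forall kq : 'I_M * rat, a < ratr kq.2 < d ->
    leb.-integrable setT (EFin \o (fun t => on (f kq.1) (t, y))) ->
    leb.-integrable setT (EFin \o (fun t => on (g kq.1) (t, y))) ->
    leb.-integrable setT (EFin \o (fun t => t * on (g kq.1) (t, y))) ->
    \int[leb]_(t in `[a, ratr kq.2]) on (f kq.1) (t, y) =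
      ratr kq.2 * \int[leb]_(t in `[a, ratr kq.2]) on (g kq.1) (t, y) -
      \int[leb]_(t in `[a, ratr kq.2]) (t * on (g kq.1) (t, y)).
  apply: ae_forall_count => -[k q] /=.
  have [aqd|naqd] := boolP (a < ratr q < d); last exact: aeW.
  have := slice_identity oO (wDu j k) cO aa1 (f0 k) aqd.
  by apply: ae_mono => y H _; exact: H.
have ton k y t : on (fun x => s * x ord0 j * g k x) (t, y) = t * on (g k) (t, y).
  have [Pty|Pty] := pselect ((`]a, d[%classic `*` obox lo hi) (t, y)).
    by rewrite !(on_slabE j b _ Pty) sign_rV_insertE.
  by rewrite !(on_slab_eq0 j b _ Pty) mulr0.
have gW : \forall x \ae mu, forall k, D x ->
    `|g k x| <= `|V x| * \sum_l `|f l x|.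
  move: Duu; apply: ae_mono => x Duu k Dx; rewrite normrM normr_sign mul1r.
  rewrite (le_trans (coord_le_enorm _ _ _))// (le_trans (Duu (DO _ Dx)))//.
  have e0 : 0 <= enorm (u x) by exact: sqrtr_ge0.
  rewrite (@le_trans _ _ (`|V x| * enorm (u x)))// ?ler_wpM2r ?ler_norm//.
  by rewrite ler_wpM2l// enorm_row_le_sum.
have GW : \forall y \ae lebesgue_rV, \forall t \ae leb, forall k,
    `|on (g k) (t, y)| <= on (fun x => `|V x|) (t, y) * \sum_l `|on (f l) (t, y)|.
  suff H : \forall p \ae nu, forall k,
      `|on (g k) p| <= on (fun x => `|V x|) p * \sum_l `|on (f l) p|.
    exact: ae_slice H.
  move: (ae_rV_insert j b gW); apply: ae_mono => p gWp k.
  have [Pp|Pp] := pselect ((`]a, d[%classic `*` obox lo hi) p).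
    rewrite !(on_slabE j b _ Pp); under eq_bigr do rewrite (on_slabE j b _ Pp).
    by apply: gWp; move: Pp; rewrite -(preimage_slab j b).
  by rewrite !(on_slab_eq0 j b _ Pp) normr0 mul0r.
have slice0 : \forall y \ae lebesgue_rV, \forall t \ae leb, forall k,
    on (f k) (t, y) = 0.
  have H1 : \forall y \ae lebesgue_rV,
      (forall k, leb.-integrable setT (EFin \o (fun t => on (f k) (t, y)))) /\
      (forall k, leb.-integrable setT (EFin \o (fun t => on (g k) (t, y)))) /\
      (forall k, leb.-integrable setT (EFin \o (fun t => t * on (g k) (t, y)))).
    move: Fi Gi tGi; apply: ae_mono3 => y Fi Gi tGi; split => //; split => // k.
    rewrite (_ : (fun t => t * _) =
      (fun t => on (fun x => s * x ord0 j * g k x) (t, y))); first exact: tGi.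
    by apply/funext => t; rewrite ton.
  move: (ae_mono3 (fun y a b c => conj a (conj b c)) Wi idn GW) => H2.
  move: H1 H2; apply: ae_mono2 => y [Fy [Gy tGy]] [Wy [idy GWy]].
  have := @gronwall_system R M (fun k t => on (f k) (t, y))
    (fun k t => on (g k) (t, y)) (fun t => on (fun x => `|V x|) (t, y)) a d
    Fy Gy tGy Wy.
  have Hid k q : a < ratr q < d -> _ := fun aqd => idy (k, q) aqd (Fy k) (Gy k) (tGy k).
  move=> /(_ Hid) H.
  have {}H := H (ae_mono (fun t h _ => h) GWy).
  apply: ae_mono H => t H k.
  have [tad|tad] := boolP (a < t < d); first exact: H.
  by rewrite on_slab_eq0// => -[/=]; rewrite in_itv/= (negbTE tad).
(* Back from lines to the slab: the L^1 norm of [f k] is an iterated integral of slices that vanish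
   almost everywhere. *)
have fk0 k : \forall x \ae mu, D x -> f k x = 0.
  have I0 : (\int[mu]_(x in D) `|(EFin \o f k) x| = 0)%E.
    rewrite (integral_on_slab (fi k)).
    apply: ae_of_slices; first exact: integrable_on_slab.
    move: slice0; apply: ae_mono => y; apply: ae_mono => t; exact.
  have := (ae_eq_integral_abs mu mD (measurable_int _ (fi k))).1 I0.
  by apply: ae_mono => x H Dx; have [] := H Dx.
have := ae_forall_fin fk0; apply: ae_mono => x H Dx.
by apply/rowP => k; rewrite mxE; exact: H.
Qed.

End half_sweep.

(** * Boxes as neighbourhoods *)

Section box_neighborhoods.
Context {R : realType} {n : nat}.
Implicit Types (x : 'rV[R]_n) (L H : 'I_n -> R).

Lemma open_obox L H : open (obox L H).
Proof.
rewrite openE => x xLH; rewrite /interior.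
suff Hi i : \forall y \near x, L i < (y : 'rV[R]_n) ord0 i < H i.
  have := @filter_forall _ _ (fun i (y : 'rV[R]_n) => L i < y ord0 i < H i) (nbhs x) _ Hi.
  exact.
have /andP[Lx xH] := xLH i.
have cx : (fun y : 'rV[R]_n => y ord0 i) @ x --> x ord0 i by exact: coord_continuous.
have : \forall t \near x ord0 i, L i < t < H i.
  by near=> t; apply/andP; split; near: t; [exact: lt_nbhsr|exact: lt_nbhsl].
exact: cx.
Unshelve. all: by end_near. Qed.

Lemma nbhs_cbox x (A : set 'rV[R]_n) : nbhs x A ->
  exists2 r : R, 0 < r & cbox (fun i => x ord0 i - r) (fun i => x ord0 i + r) `<=` A.
Proof.
(* Balls are open cubes for the sup norm; half the radius fits a closed cube inside. *)
move=> /nbhs_ballP[e /= e0 eA]; exists (e / 2); first exact: divr_gt0.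
move=> y Hy; apply: eA; split => // i i'; rewrite ord1 /ball/=.
have /andP[h1 h2] := Hy i'.
rewrite distrC (@le_lt_trans _ _ (e / 2))//; last first.
  by rewrite ltr_pdivrMr// ltr_pMr// ltr1n.
by rewrite ler_distl h1 h2.
Qed.

Lemma obox_center x (r : R) : 0 < r ->
  obox (fun i => x ord0 i - r) (fun i => x ord0 i + r) x.
Proof. by move=> r0 i; rewrite ltrBlDr !ltrDl r0. Qed.

Lemma obox_sub L H L' H' : (forall i, L i <= L' i) -> (forall i, H' i <= H i) ->
  obox L' H' `<=` obox L H.
Proof.
move=> LL HH x Hx i; have /andP[? ?] := Hx i.
by rewrite (le_lt_trans (LL i))//= (lt_le_trans _ (HH i)).
Qed.

Lemma cbox_sub L H L' H' : (forall i, L i <= L' i) -> (forall i, H' i <= H i) ->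
  cbox L' H' `<=` cbox L H.
Proof.
move=> LL HH x Hx i; have /andP[? ?] := Hx i.
by rewrite (le_trans (LL i))//= (le_trans _ (HH i)).
Qed.

Lemma rat_obox L H x : obox L H x -> exists c : {ffun 'I_n -> rat} * {ffun 'I_n -> rat},
  obox (fun i => ratr (c.1 i)) (fun i => ratr (c.2 i)) x /\
  obox (fun i => ratr (c.1 i)) (fun i => ratr (c.2 i)) `<=` obox L H.
Proof.
move=> xLH.
have /fin_all_exists[p Hp] : forall i, exists q : rat, L i < ratr q < x ord0 i.
  move=> i; have /andP[Lx _] := xLH i; have [q] := rat_in_itvoo Lx.
  by rewrite in_itv/=; exists q.
have /fin_all_exists[q Hq] : forall i, exists q : rat, x ord0 i < ratr q < H i.
  move=> i; have /andP[_ xH] := xLH i; have [q] := rat_in_itvoo xH.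
  by rewrite in_itv/=; exists q.
exists (finfun p, finfun q); split=> [i|] /=.
  by rewrite !ffunE; have /andP[_ ->] := Hp i; have /andP[-> _] := Hq i.
apply: obox_sub => i; rewrite ffunE.
  by have /andP[/ltW] := Hp i.
by have /andP[_ /ltW] := Hq i.
Qed.

End box_neighborhoods.

(** * Sweeping boxes, and connectedness *)

Section unique_continuation.
Context {R : realType} {m M : nat} (Omega : set 'rV[R]_m.+1)
  (V : 'rV[R]_m.+1 -> R) (u : 'rV[R]_m.+1 -> 'rV[R]_M)
  (Du : 'rV[R]_m.+1 -> 'M[R]_(m.+1, M)).
Local Notation mu := (@lebesgue_rV R m.+1).
Hypotheses (oO : open Omega) (LV : Lploc 2 Omega V) (wDu : weak_gradient Omega u Du)
  (Duu : \forall x \ae mu, Omega x -> enorm (Du x) <= V x * enorm (u x)).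
Implicit Types L H : 'I_m.+1 -> R.

Definition ae_zero_on (A : set 'rV[R]_m.+1) := \forall x \ae mu, A x -> u x = 0.

Lemma ae_zero_onS A B : A `<=` B -> ae_zero_on B -> ae_zero_on A.
Proof. by move=> AB; apply: ae_mono => x uB Ax; exact/uB/AB. Qed.

(** The slab going up from [l] and the reflected one going down from [h] both begin with the strip
    between [l] and [h]. They cover the box because [l < h]. *)
Lemma coord_sweep L H (j : 'I_m.+1) (l h : R) : cbox L H `<=` Omega ->
  L j <= l -> l < h -> h <= H j ->
  ae_zero_on (obox L H `&` [set x | l < x ord0 j < h]) ->
  ae_zero_on (obox L H).
Proof.
move=> cO Ll lh hH u0.
pose lo k := L (lift j k); pose hi k := H (lift j k).
have right : ae_zero_on (slab j false l (H j) lo hi).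
  apply: (slab_sweep oO LV wDu Duu _ lh).
    apply: subset_trans cO; apply: cbox_sub => i; rewrite /slab_lo /slab_hi;
      by case: (unliftP j i) => [k ->|->].
  move: u0; apply: ae_mono => x u0 /(oboxE j false).
  rewrite slab_start slab_end expr0 mul1r => -[/andP[lx xH] xi] xh.
  apply: u0; split; last by rewrite /= lx.
  move=> i; case: (unliftP j i) => [k ->|->]; last by rewrite (le_lt_trans Ll).
  by have := xi k; rewrite /slab_lo /slab_hi liftK.
have left : ae_zero_on (slab j true (- h) (- L j) lo hi).
  have hl : - h < - l by rewrite ltrN2.
  apply: (slab_sweep oO LV wDu Duu _ hl).
    apply: subset_trans cO; apply: cbox_sub => i; rewrite /slab_lo /slab_hi;
      by case: (unliftP j i) => [k ->|->]; rewrite ?opprK.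
  move: u0; apply: ae_mono => x u0 /(oboxE j true).
  rewrite slab_start slab_end expr1 mulN1r !ltrN2 => -[/andP[xh Lx] xi] lx.
  apply: u0; split; last by rewrite /= lx.
  move=> i; case: (unliftP j i) => [k ->|->]; last by rewrite Lx (lt_le_trans xh).
  by have := xi k; rewrite /slab_lo /slab_hi liftK.
move: right left; apply: ae_mono2 => x ur ul xLH.
have /andP[Lx xH] := xLH j.
have xi k : lo k < x ord0 (lift j k) < hi k by exact: xLH.
have [xh|xh] := ltP (x ord0 j) h.
  apply: ul; apply/(oboxE j true).
  rewrite slab_start slab_end expr1 mulN1r !ltrN2 xh Lx; split => // k.
  by rewrite /slab_lo /slab_hi liftK; exact: xi.
apply: ur; apply/(oboxE j false).
rewrite slab_start slab_end expr0 mul1r xH (lt_le_trans lh xh); split => // k.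
by rewrite /slab_lo /slab_hi liftK; exact: xi.
Qed.

Lemma box_sweep L H L' H' : cbox L H `<=` Omega ->
  (forall i, L i <= L' i) -> (forall i, L' i < H' i) -> (forall i, H' i <= H i) ->
  ae_zero_on (obox L' H') -> ae_zero_on (obox L H).
Proof.
move=> cO LL LH HH u0.
(* The first [k] coordinates are bounded by the large box, the others by the small one, so that step
   [k] is a sweep in direction [k]. *)
pose mixL k (i : 'I_m.+1) := if (i < k)%N then L i else L' i.
pose mixH k (i : 'I_m.+1) := if (i < k)%N then H i else H' i.
suff Hk k : (k <= m.+1)%N -> ae_zero_on (obox (mixL k) (mixH k)).
  apply: ae_zero_onS (Hk m.+1 (leqnn _)).
  by apply: obox_sub => i; rewrite /mixL /mixH ltn_ord.
elim: k => [_|k IH km].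
  by apply: ae_zero_onS u0; apply: obox_sub => i.
pose j := Ordinal km.
apply: (@coord_sweep _ _ j (L' j) (H' j)) => //.
- apply: subset_trans cO; apply: cbox_sub => i; rewrite /mixL /mixH;
    by case: ifP.
- by rewrite /mixL ltnSn.
- by rewrite /mixH ltnSn.
- apply: ae_zero_onS (IH (ltnW km)) => x [xk /= xj] i.
  have [ij|ij] := eqVneq i j.
    by rewrite ij /mixL /mixH ltnn.
  have := xk i; rewrite /mixL /mixH ltnS leq_eqVlt.
  have -> : (i == k :> nat) = false by apply/negbTE.
  by [].
Qed.

Lemma connected_ae_zero_on (U : set 'rV[R]_m.+1) : connected Omega ->
  open U -> U !=set0 -> U `<=` Omega -> ae_zero_on U -> ae_zero_on Omega.
Proof.
move=> conn oU [x0 Ux0] UO uU.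
(* As a union of open boxes [C] is open; the sweep is what makes it closed relative to [Omega]. *)
pose C := \bigcup_(B in [set B | exists L H, B = obox L H /\ ae_zero_on (obox L H)]) B.
have oC : open C by apply: bigcup_open => _ [L [H [-> _]]]; exact: open_obox.
have CE x : C x <-> exists L H, obox L H x /\ ae_zero_on (obox L H).
  split=> [[_ [L [H [-> uLH]]] xLH]|[L [H [xLH uLH]]]]; first by exists L, H.
  by exists (obox L H) => //; exists L, H.
have boxC x (A : set 'rV[R]_m.+1) : open A -> A x -> exists2 r : R, 0 < r &
    cbox (fun i => x ord0 i - r) (fun i => x ord0 i + r) `<=` A.
  by move=> oA Ax; apply: nbhs_cbox; exact: open_nbhs_nbhs.
have OC : Omega `&` C = Omega.
  apply: conn.
  - exists x0; split; first exact: UO.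
    have [r r0 rU] := boxC _ _ oU Ux0.
    apply/CE; exists (fun i => x0 ord0 i - r), (fun i => x0 ord0 i + r); split.
      exact: obox_center.
    by apply: ae_zero_onS uU; exact: subset_trans (@obox_cbox _ _ _ _) rU.
  - by exists C.
  - exists (closure C); first exact: closed_closure.
    apply/seteqP; split=> x [Ox Cx]; split => //; first exact: subset_closure.
    have [r r0 rO] := boxC _ _ oO Ox.
    set L0 := (fun i => x ord0 i - r); set H0 := (fun i => x ord0 i + r).
    have xLH : obox L0 H0 x by exact: obox_center.
    have [z [Cz zLH]] := Cx _ (open_nbhs_nbhs (conj (@open_obox _ _ L0 H0) xLH)).
    have [L [H [zL uLH]]] := (CE z).1 Cz.
    apply/CE; exists L0, H0; split => //.
    (* The box where [u] vanishes and the cube around [x] share [z], so they intersect in a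
       nondegenerate box, from which the zeros spread over the cube. *)
    apply: (@box_sweep _ _ (fun i => Num.max (L i) (L0 i))
      (fun i => Num.min (H i) (H0 i)) rO).
    + by move=> i; rewrite le_max lexx orbT.
    + move=> i; have /andP[? ?] := zL i; have /andP[? ?] := zLH i.
      by apply: (@lt_trans _ _ (z ord0 i)); rewrite ?gt_max ?lt_min; exact/andP.
    + by move=> i; rewrite ge_min lexx orbT.
    + apply: ae_zero_onS uLH; apply: obox_sub => i; first by rewrite le_max lexx.
      by rewrite ge_min lexx.
pose rbox (c : {ffun 'I_m.+1 -> rat} * {ffun 'I_m.+1 -> rat}) : set 'rV[R]_m.+1 :=
  obox (fun i => ratr (c.1 i)) (fun i => ratr (c.2 i)).
(* The boxes making up [C] are uncountably many; each point of [C] lies in a rational box on which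
   [u] vanishes, and these contribute countably many null sets. *)
have cover : \forall x \ae mu, forall c, ae_zero_on (rbox c) -> rbox c x -> u x = 0.
  apply: ae_forall_count => c; have [uc|nuc] := pselect (ae_zero_on (rbox c)).
    by move: (uc); apply: ae_mono => x ux _; exact: ux.
  exact: aeW.
apply: ae_mono cover => x cx Ox.
have /CE[L [H [xLH uLH]]] : C x by move: Ox; rewrite -{1}OC => -[].
have [c [xc cLH]] := rat_obox xLH.
by apply: (cx c) => //; exact: ae_zero_onS cLH uLH.
Qed.

End unique_continuation.

Theorem theorem2p7 (R : realType) (n M : nat) (Omega : set 'rV[R]_n)
    (V : 'rV[R]_n -> R) (u : 'rV[R]_n -> 'rV[R]_M)
    (Du : 'rV[R]_n -> 'M[R]_(n, M)) (U : set 'rV[R]_n) :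
  (2 <= n)%N ->
  open Omega -> connected Omega ->
  Lploc 2 Omega V ->
  (forall k, H1loc Omega (fun x => u x ord0 k)) ->
  weak_gradient Omega u Du ->
  (\forall x \ae lebesgue_rV, Omega x -> enorm (Du x) <= V x * enorm (u x)) ->
  open U -> U !=set0 -> U `<=` Omega ->
  (\forall x \ae lebesgue_rV, U x -> u x = 0) ->
  \forall x \ae lebesgue_rV, Omega x -> u x = 0.
Proof.
case: n Omega V u Du U => [//|m] Omega V u Du U _ oO conn LV _ wDu Duu oU U0 UO uU.
exact: (connected_ae_zero_on oO LV wDu Duu conn oU U0 UO uU).
Qed.
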